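(* Let $Z=\mathbb R^{2N}$, let $E$ be an affine subspace of $Z$ of dimension $N$, $E_0$ the translate of $E$ through the origin, $E_0^\perp$ the orthogonal complement of $E_0$, and $\mu\in\mathcal M(Z\times Z)$. Assume: (i) $\mu=\mu_D\times(\mathcal H^N\llcorner E)$ with $\mu_D=L_D\,\mathcal L^{2N}$ and $L_D\in L^1_{\rm loc}(Z)$ non-negative. (ii) $L_D(\xi)=\lim_{\lambda\to+\infty}L_D(\xi+\eta/\lambda)$ for $\mathcal H^N$-a.e. $\xi\in E$ and $\mathcal H^N$-a.e. $\eta\in E_0^\perp$. (iii) There are $g_0\in L^1(E\times E_0^\perp\times E_0;\mathcal H^{3N})$, $\lambda_0>0$ and $\beta_0>0$ such that $e^{-\beta_0(\|\eta\|^2+\|\zeta\|^2)}L_D(\xi+\eta/\lambda)\le g_0(\xi,\eta,\zeta)$ for $\mathcal H^{3N}$-a.e. $(\xi,\eta,\zeta)\in E\times E_0^\perp\times E_0$ and all $\lambda\ge\lambda_0$. Let $(\mu_{D,h})_{h\in\mathbb N}$ be a sequence of measures in $\mathcal M(Z)$ and $\mu_h:=\mu_{D,h}\times(\mathcal H^N\llcorner E)\in\mathcal M(Z\times Z)$. Let $(\beta_h)$ be a sequence of positive numbers diverging to $+\infty$ and set $\lambda_h:=\sqrt{\beta_h/\beta_0}$, with $\beta_0$ as in (iii). Assume additionally: (iv) For every $h\in\mathbb N$ there is a Borel map $T_{D,h}:Z\to Z$ such that $\mu_{D,h}=T_{D,h}\#\mu_D$. Write $T_h(y,z)=(T_{D,h}(y),z)$.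 (v) For every $(\xi,\eta,\zeta)\in E\times E_0^\perp\times E_0$, $$\lim_{h\to\infty}S_{\lambda_h}^{-1}\circ T_h\circ S_{\lambda_h}(\xi,\eta,\zeta)=(\xi,\eta,\zeta).$$ (vi) There are $g\in L^1(E\times E_0^\perp\times E_0;\mathcal H^{3N})$ and $h_0\in\mathbb N$ such that for every $h\ge h_0$ and every $(\xi,\eta,\zeta)\in E\times E_0^\perp\times E_0$ $$\big[\hat w_{\beta_0}(\eta,\zeta)+\hat w_{\beta_0}(\eta_h',\zeta_h')\big]\,L_D\Big(\xi+\frac{\eta}{\lambda_h}\Big)\le g(\xi,\eta,\zeta),$$ where $(\xi_h',\eta_h',\zeta_h'):=S_{\lambda_h}^{-1}\circ T_h\circ S_{\lambda_h}(\xi,\eta,\zeta)$. Then $$\mathop{w\text{-}\lim}_{h\to\infty}\,(\mu_{h,\beta_h}-\mu_{\beta_h})=0$$ in $\mathcal M_b(Z\times Z)$, i.e. $\mu_{h,\beta_h}(f)-\mu_{\beta_h}(f)\to0$ as $h\to\infty$ for all $f\in C_b(Z\times Z)$.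
   Context: $N\ge1$ is an integer; $Z=\mathbb R^{2N}$ is endowed with a scalar product, with corresponding norm $\|\cdot\|$; orthogonality refers to this scalar product. For a metric space $X$, $\mathcal M(X)$ is the set of (positive) Radon measures on $X$ and $\mathcal M_b(X)=\{\mu\in\mathcal M(X):\mu(X)<\infty\}$; $\mu(f):=\int_X f\,d\mu$; $C_b(X)$ is the set of bounded continuous real functions on $X$. The weak limit statement is understood with $\mu_{h,\beta_h},\mu_{\beta_h}\in\mathcal M_b(Z\times Z)$ for all sufficiently large $h$. $\mathcal H^N$ is the $N$-dimensional Hausdorff measure and $\mathcal H^N\llcorner E$ its restriction to $E$; on $E\times E_0^\perp\times E_0$, $\mathcal H^{3N}$ is the product of the three measures $\mathcal H^N$. $T\#\mu$ denotes the push-forward, $(T\#\mu)(A)=\mu(T^{-1}(A))$ for Borel $A$. $L_D:Z\to[0,\infty)$ is regarded as a fixed, pointwise defined function. For a measure $\mu\in\mathcal M(Z\times Z)$ and $\beta>0$, the thermalized measure is $$\mu_\beta:=w_\beta\,\mu,\quad w_\beta(y,z):=B_\beta^{-1}e^{-\beta\|y-z\|^2},\quad B_\beta:=\int_Z e^{-\beta\|\xi\|^2}\,d\xi ,$$ and $\mu_{h,\beta}:=w_\beta\,\mu_h$. For $\lambda>0$, $S_\lambda:E\times E_0^\perp\times E_0\to Z\times E$ is the bijection $$S_\lambda(\xi,\eta,\zeta):=\Big(\xi+\frac{\eta}{\lambda},\ \xi-\frac{\zeta}{\lambda}\Big),\qquad S_\lambda^{-1}(y,z)=\big(P_Ey,\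 \lambda(y-P_Ey),\ \lambda(P_Ey-z)\big),$$ with $P_E$ the orthogonal projection of $Z$ onto $E$. For $(\eta,\zeta)\in E_0^\perp\times E_0$, $\hat w_{\beta_0}(\eta,\zeta):=B_{\beta_0}^{-1}e^{-\beta_0\|\eta\|^2-\beta_0\|\zeta\|^2}$. *)

(* Defs.v *)
From HB Require Import structures.
From mathcomp Require Import all_boot all_order all_algebra.
From mathcomp Require Import all_classical all_reals all_analysis.

Set Implicit Arguments.
Unset Strict Implicit.
Unset Printing Implicit Defensive.

Import Order.TTheory GRing.Theory Num.Theory.
Import numFieldNormedType.Exports.

Local Open Scope classical_set_scope.
Local Open Scope ring_scope.

#[short(type=topologicalMeasurableType)]
HB.structure Definition TopologicalMeasurable (d : measure_display) :=
  {T of Measurable d T & PointedTopological T}.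

HB.instance Definition _ (d1 d2 : measure_display)
    (T1 : topologicalMeasurableType d1) (T2 : topologicalMeasurableType d2) :=
  Measurable.on (T1 * T2)%type.

Section borel_matrix.
Variables (R : realType) (m n : nat).

HB.instance Definition _ := @isMeasurable.Build
  (sigma_display (@open 'M[R]_(m, n))) 'M[R]_(m, n)
  <<s @open 'M[R]_(m, n) >>
  (@sigma_algebra0 _ setT _) (@sigma_algebraC _ _) (@sigma_algebra_bigcup _ setT _).

End borel_matrix.

Section radon_measures.
Local Open Scope ereal_scope.

(* Only the values of m on Borel sets are constrained. *)
Definition radon (R : realType) (d : measure_display)
    (T : topologicalMeasurableType d) (m : set T -> \bar R) :=
  [/\ exists nu : {measure set T -> \bar R},
        forall A, measurable A -> m A = nu A,
      forall K, compact K -> m K < +oo &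
      forall A, measurable A ->
        m A = ereal_sup [set m K | K in [set K | compact K /\ K `<=` A]]].

Definition bounded_radon (R : realType) (d : measure_display)
    (T : topologicalMeasurableType d) (m : set T -> \bar R) :=
  radon m /\ m setT < +oo.

(* If w is only a.e. equal to a Borel function, this is still the integral of
   that function: the integral of a non-negative function is the supremum of
   the integrals of the Borel simple functions below it. *)
Definition density (R : realType) (d : measure_display) (T : measurableType d)
    (m : set T -> \bar R) (w : T -> R) : set T -> \bar R :=
  fun A => \int[m]_(x in A) (w x)%:E.

Definition restriction (R : realType) (T : Type) (m : set T -> \bar R)
    (E : set T) : set T -> \bar R :=
  fun A => m (A `&` E).

(* L^1 functions are measurable with respect to the completion of m, that is,
   m-a.e. equal to a Borel function. *)
Definition L1 (R : realType) (d : measure_display) (T : measurableType d)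
    (m : set T -> \bar R) (g : T -> R) :=
  exists2 g' : T -> R, m.-integrable setT (EFin \o g') &
    {ae m, forall x, g x = g' x}.

Definition L1_loc (R : realType) (d : measure_display)
    (T : topologicalMeasurableType d) (m : set T -> \bar R) (g : T -> R) :=
  exists2 g' : T -> R,
    measurable_fun setT g' /\
    (forall K, compact K -> m.-integrable K (EFin \o g')) &
    {ae m, forall x, g x = g' x}.

(* Lebesgue measure on R^n, as an iterated product. *)
Fixpoint lebesgue (R : realType) (n : nat) : set 'rV[R]_n -> \bar R :=
  match n with
  | 0 => dirac (0%R : 'rV[R]_0)
  | n'.+1 => pushforward (@lebesgue_measure R \x @lebesgue R n')
      (fun p : measurableTypeR R * 'rV[R]_n' => row_mx (p.1)%:M p.2 : 'rV[R]_(1 + n'))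
  end.

End radon_measures.

Section hausdorff.
Local Open Scope ereal_scope.
Variables (R : realType) (V : zmodType) (nrm : V -> R).

Definition diam (A : set V) : \bar R :=
  maxe 0 (ereal_sup [set (nrm (x - y)%R)%:E | x in A & y in A]).

Definition unit_ball_volume (k : nat) : \bar R :=
  lebesgue [set x : 'rV[R]_k | (\sum_i x ord0 i ^+ 2 <= 1)%R].

(* Empty sets contribute 0, which matters only for k = 0. *)
Definition hausdorff_size (k : nat) (A : set V) : \bar R :=
  if A == set0 then 0 else unit_ball_volume k * (2^-1%:E * diam A) ^+ k.

Definition hausdorff_content (k : nat) (delta : R) (A : set V) : \bar R :=
  ereal_inf [set \sum_(0 <= i <oo) hausdorff_size k (U i) | U in
    [set U : (set V)^nat | (forall i, diam (U i) <= delta%:E) /\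
                           A `<=` \bigcup_i U i]].

Definition hausdorff (k : nat) (A : set V) : \bar R :=
  ereal_sup [set hausdorff_content k delta A | delta in [set delta | (0 < delta)%R]].

End hausdorff.

Section thermalization.
Variables (R : realType) (n : nat) (dot : {dot 'rV[R]_n for idfun}).
Notation Z := 'rV[R]_n.

Definition dnorm (x : Z) : R := Num.sqrt (dot x x).

Definition gauss_mass (beta : R) : R :=
  fine (\int[@lebesgue R n]_xi (expR (- beta * dnorm xi ^+ 2))%:E)%E.

Definition thermal_weight (beta : R) (p : Z * Z) : R :=
  (gauss_mass beta)^-1 * expR (- beta * dnorm (p.1 - p.2) ^+ 2).

Definition thermalized (beta : R) (mu : set (Z * Z) -> \bar R) :
    set (Z * Z) -> \bar R :=
  density mu (thermal_weight beta).

Definition w_hat (beta0 : R) (eta zeta : Z) : R :=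
  (gauss_mass beta0)^-1 * expR (- beta0 * dnorm eta ^+ 2 - beta0 * dnorm zeta ^+ 2).

Definition lift_fst (T : Z -> Z) (q : Z * Z) : Z * Z := (T q.1, q.2).

Variables (a : Z) (E0 : {vspace Z}).

Definition affine_subspace : set Z := [set a + v | v in [set` E0]].

Definition orthogonal_complement : set Z :=
  [set x | forall v, v \in E0 -> dot x v = 0].

Definition orth_proj (y : Z) : Z :=
  get [set p | affine_subspace p /\ orthogonal_complement (y - p)].

(* E x E0^perp x E0, as a subset of Z x Z x Z. *)
Definition triples : set (Z * Z * Z) :=
  affine_subspace `*` orthogonal_complement `*` [set` E0].

Definition S_map (lambda : R) (p : Z * Z * Z) : Z * Z :=
  let: (xi, eta, zeta) := p in
  (xi + lambda^-1 *: eta, xi - lambda^-1 *: zeta).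

Definition S_inv (lambda : R) (q : Z * Z) : Z * Z * Z :=
  let: (y, z) := q in
  (orth_proj y, lambda *: (y - orth_proj y), lambda *: (orth_proj y - z)).

Definition S_conj (lambda : R) (T : Z * Z -> Z * Z) (p : Z * Z * Z) :
    Z * Z * Z :=
  S_inv lambda (T (S_map lambda p)).

Definition hausdorff_on (k : nat) (A : set Z) : set Z -> \bar R :=
  restriction (hausdorff dnorm k) A.

(* H^{3k} on E x E0^perp x E0, as a measure on Z x Z x Z. *)
Definition hausdorff3 (k : nat) : set (Z * Z * Z) -> \bar R :=
  (hausdorff_on k affine_subspace \x hausdorff_on k orthogonal_complement
     \x hausdorff_on k [set` E0])%E.

End thermalization.

(* Main.v *)
(* In the variables (xi, eta, zeta) = S_lambda^-1(y, z), with
   lambda_h = sqrt(beta_h / beta0), the weight of mu_{beta_h} becomes a fixed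
   Gaussian: for bounded continuous F >= 0,
     mu_{beta_h}(F)   = c int F(S p) w^(p) LD(xi + eta/lambda_h) dH^{3N}(p),
     mu_{h,beta_h}(F) = c int F(S p') w^(p') LD(xi + eta/lambda_h) dH^{3N}(p),
   where S = S_{lambda_h} and p' = S^-1 T_h S p.  By (v) both S p and S p' tend
   to (xi, xi) and w^(p') tends to w^(p); LD(xi + eta/lambda_h) stays bounded by
   (ii), and (vi) provides the dominating function, so dominated convergence
   applies to the difference of the two integrands.

   The change of variables needs L^{2N} = c (H^N|E * H^N|E0^perp) for some
   constant c only, so the isodiametric inequality is avoided: both sides are
   translation invariant.  That H^N|E is a locally finite Borel measure is read
   off from mu = mu_D x H^N|E being a Radon measure (if mu_D or H^N|E vanishes,
   there is nothing to prove), and it is transferred to E0 and E0^perp by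
   isometries. *)

Require Import Defs.
From HB Require Import structures.
From mathcomp Require Import all_boot all_order all_algebra.
From mathcomp Require Import all_classical all_reals all_analysis.
From mathcomp Require Import measurable_realfun.
From mathcomp Require Import ring lra.

Set Implicit Arguments.
Unset Strict Implicit.
Unset Printing Implicit Defensive.

Import Order.TTheory GRing.Theory Num.Theory.
Import numFieldNormedType.Exports.

Local Open Scope classical_set_scope.
Local Open Scope ring_scope.

Import HBNNSimple.

(** The set functions of the statement (Hausdorff, [lebesgue], [density]) are not bundled measures:
    each agrees with a measure on Borel sets only, and Tonelli asks for sigma-finiteness. Hence all
    integrals are moved to sigma-finite measures [L], [nuE], [nuP], [nu0].

    [LD] is only a.e. equal to a Borel function, whereas (ii) and (vi) concern its pointwise values.
    It is replaced by a Borel [v] with [v <= LD] everywhere and equality a.e.: integrals do not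
    change, and every upper bound drawn from (ii) or (vi) passes to [v] at each point. Upper bounds
    suffice, because the integrand of the difference is [v] times a factor tending to 0.

    The weight loses its dependence on h by a cancellation: S_lambda dilates eta and zeta, each in
    dimension N, which costs lambda^(-2N), and B_beta with beta = beta0 lambda^2 equals lambda^(-2N)
    B_beta0. This uses dim Z = 2 dim E.

    Proportionality of translation-invariant measures comes from measuring the set of pairs (x, y)
    with x in A and x + y in B in both orders. *)

(* Library lemmas only compare integrals against bundled measures. *)
Lemma eq_set_function_integral d (T : measurableType d) (R : realType)
    (m1 m2 : set T -> \bar R) (D : set T) (f : T -> \bar R) :
  (forall A, measurable A -> m1 A = m2 A) ->
  (\int[m1]_(x in D) f x = \int[m2]_(x in D) f x)%E.
Proof.
move=> e; have es (h : {nnsfun T >-> R}) :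
    sintegral m1 h = sintegral m2 h.
  by apply: eq_fsbigr => r _; rewrite e.
rewrite /integral; congr (ereal_sup _ - ereal_sup _)%E;
  by apply/seteqP; split => _ [h hf <-]; exists h.
Qed.

(** * Measures with a density; bundling of sigma-finite and product measures *)

(** The two proofs do not affect the value; they are kept as arguments of the head symbol so that a
    measure structure can be attached to it. *)
Definition mdensity d (T : measurableType d) (R : realType)
    (mu : {measure set T -> \bar R}) (w : T -> R)
    of measurable_fun setT w & (forall x, 0 <= w x) : set T -> \bar R :=
  density mu w.

Section density_measure.
Local Open Scope ereal_scope.
Context d (T : measurableType d) (R : realType).
Variables (mu : {measure set T -> \bar R}) (w : T -> R).
Hypothesis mw : measurable_fun setT w.
Hypothesis w0 : forall x, (0 <= w x)%R.

Local Notation nu := (mdensity mu mw w0).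

Let mdensity0 : nu set0 = 0.
Proof. exact: integral_set0. Qed.

Let mdensity_ge0 A : 0 <= nu A.
Proof. by apply: integral_ge0 => x _; rewrite lee_fin. Qed.

Let mdensity_sigma_additive : semi_sigma_additive nu.
Proof.
move=> F mF tF mUF; rewrite /mdensity /density ge0_integral_bigcup//.
- apply: is_cvg_ereal_nneg_natsum_cond => n _ _.
  exact: mdensity_ge0.
- by apply/measurable_EFinP; exact: measurable_funTS.
- by move=> x _; rewrite lee_fin.
Qed.

HB.instance Definition _ := isMeasure.Build _ _ _ nu
  mdensity0 mdensity_ge0 mdensity_sigma_additive.

(** Monotone convergence along the simple approximations of [f] reduces the identity to indicators,
    where it is the definition of [density]. *)
Lemma integral_mdensity (f : T -> \bar R) :
  measurable_fun setT f -> (forall x, 0 <= f x) ->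
  \int[nu]_x f x = \int[mu]_x (f x * (w x)%:E).
Proof.
move=> mf f0; pose h := nnsfun_approx measurableT mf.
have -> : \int[nu]_x f x =
    lim (\int[nu]_x (EFin \o h n) x @[n --> \oo]).
  have fE x : setT x -> f x = lim ((EFin \o h n) x @[n --> \oo]).
    by move=> Ex; apply/esym/cvg_lim => //; exact: cvg_nnsfun_approx.
  under eq_integral => x /[!inE] /fE -> //.
  apply: monotone_convergence => //.
  - by move=> n; exact/measurable_EFinP/measurable_funP.
  - by move=> n x Ex //=; rewrite lee_fin.
  - by move=> x Ex a b ab; rewrite lee_fin; exact/lefP/nd_nnsfun_approx.
have -> : \int[mu]_x (f x * (w x)%:E) =
    lim (\int[mu]_x ((EFin \o h n) \* (EFin \o w)) x @[n --> \oo]).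
  have fg x : setT x ->
      f x * (w x)%:E = lim (((EFin \o h n) \* (EFin \o w)) x @[n --> \oo]).
    by move=> Ex; apply/esym/cvg_lim => //; apply: cvgeZr => //;
      exact: cvg_nnsfun_approx.
  under eq_integral => x /[!inE] /fg -> //.
  apply: monotone_convergence => [//| | |].
  - by move=> n; apply/emeasurable_funM; exact/measurable_EFinP.
  - by move=> n x Ex /=; rewrite mule_ge0 ?lee_fin.
  - by move=> x Ex a b ab/=; rewrite lee_wpmul2r ?lee_fin//;
      exact/lefP/nd_nnsfun_approx.
suff suf n : \int[mu]_x ((EFin \o h n) x * (w x)%:E) =
    \int[nu]_x (EFin \o h n) x.
  by under [in RHS]eq_fun do rewrite suf.
transitivity (\int[nu]_x
   (\sum_(y \in range (h n)) (y * \1_(h n @^-1` [set y]) x)%:E)); last first.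
  by apply: eq_integral => t tE; rewrite /= fimfunE -fsumEFin.
have indich m r : measurable_fun setT (fun x => (r * \1_(h m @^-1` [set r]) x)%:E).
  by apply: (measurable_comp measurableT) => //; exact: measurable_funM.
rewrite ge0_integral_fsum//; last by move=> m y Ey; exact: nnfun_muleindic_ge0.
transitivity (\int[mu]_x (\sum_(y \in range (h n))
    (y * \1_(h n @^-1` [set y]) x)%:E * (w x)%:E)).
  under [RHS]eq_integral => x xE.
    rewrite -ge0_mule_fsuml => [|y]; last exact: nnfun_muleindic_ge0.
    rewrite fsumEFin // -(fimfunE _ x); over.
  by [].
rewrite ge0_integral_fsum//; last 2 first.
  - by move=> y; apply: emeasurable_funM => //; exact/measurable_EFinP.
  - by move=> m y Ey; apply: mule_ge0; rewrite ?nnfun_muleindic_ge0 ?lee_fin.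
apply: eq_fsbigr => r rhn.
under [RHS]eq_integral do rewrite EFinM.
rewrite integralZl_indic_nnsfun => //.
under eq_integral do rewrite EFinM -muleA.
rewrite ge0_integralZl//.
- under eq_integral do rewrite muleC.
  rewrite (eq_integral ((EFin \o w) \_ (h n @^-1` [set r]))); last first.
    by move=> x xE; rewrite epatch_indic.
  by rewrite -integral_mkcondr integral_indic// setTI setIT.
- by apply: emeasurable_funM; exact/measurable_EFinP.
- by move=> t Et; rewrite mule_ge0 ?lee_fin.
- by move: rhn; rewrite inE => -[t _ <-]; rewrite lee_fin.
Qed.

End density_measure.

Section sigma_finite_pack.
Context d (T : measurableType d) (R : realType).

(** An alias that carries a proof of sigma-finiteness, from which the bundled structure is
    inferred. *)
Definition sigma_finite_copy (m : {measure set T -> \bar R})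
  of sigma_finite setT m : set T -> \bar R := m.

Section sigma_finite_copy.
Variables (m : {measure set T -> \bar R}) (sm : sigma_finite setT m).

HB.instance Definition _ := Measure.on (sigma_finite_copy sm).
HB.instance Definition _ := Measure_isSigmaFinite.Build _ _ _
  (sigma_finite_copy sm) sm.

End sigma_finite_copy.

Lemma sigma_finite_measureP (m : {measure set T -> \bar R}) :
  sigma_finite setT m ->
  exists m' : {sigma_finite_measure set T -> \bar R}, forall A, m' A = m A.
Proof. by move=> sm; exists (sigma_finite_copy sm). Qed.

(** The product integrates the values of [m2] on sections of [A], which are Borel, so nothing
    depends on values at other sets. This is how Hausdorff set functions inside a product are
    exchanged for genuine measures. *)
Lemma product_measure1_eq d' (T' : measurableType d')
    (m1 : set T -> \bar R) (n1 : {measure set T -> \bar R})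
    (m2 : set T' -> \bar R) (n2 : {measure set T' -> \bar R}) A :
  (forall A, measurable A -> m1 A = n1 A) ->
  (forall A, measurable A -> m2 A = n2 A) ->
  measurable A -> (m1 \x m2)%E A = (n1 \x n2)%E A.
Proof.
move=> e1 e2 mA; rewrite /product_measure1.
transitivity (\int[n1]_x (m2 \o xsection A) x)%E.
  exact: eq_set_function_integral.
by apply: eq_integral => x _ /=; rewrite e2//; exact: measurable_xsection.
Qed.

Lemma negligible_eq (m n : set T -> \bar R) A :
  (forall A, measurable A -> m A = n A) -> m.-negligible A -> n.-negligible A.
Proof. by move=> e [B [mB B0 AB]]; exists B; split => //; rewrite -e. Qed.

End sigma_finite_pack.

Lemma product_null1 d d' (T : measurableType d) (T' : measurableType d')
    (R : realType) (m1 : {measure set T -> \bar R})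
    (m2 : {sigma_finite_measure set T' -> \bar R}) A :
  measurable A -> m1 A = 0%E -> (m1 \x m2)%E (A `*` setT) = 0%E.
Proof. by move=> mA A0; rewrite product_measure1E// A0 mul0e. Qed.

Lemma product_null2 d d' (T : measurableType d) (T' : measurableType d')
    (R : realType) (m1 : {measure set T -> \bar R})
    (m2 : {sigma_finite_measure set T' -> \bar R}) A :
  measurable A -> m2 A = 0%E -> (m1 \x m2)%E (setT `*` A) = 0%E.
Proof. by move=> mA A0; rewrite product_measure1E// A0 mule0. Qed.

(* The integral of a function that is only a.e. equal to a Borel one is, by
   definition, a supremum over the Borel simple functions below it; cutting the
   function off on a Borel null set makes it Borel without changing that. *)
Lemma ae_measurable_minorant d (T : measurableType d) (R : realType)
    (m : {measure set T -> \bar R}) (w w' : T -> R) :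
  (forall x, 0 <= w x) -> measurable_fun setT w' ->
  {ae m, forall x, w x = w' x} ->
  exists v : T -> R, [/\ measurable_fun setT v, forall x, 0 <= v x,
    forall x, v x <= w x,
    {ae m, forall x, v x = w x} &
    forall A, measurable A -> density m w A = density m v A].
Proof.
move=> w0 mw' [N [mN N0 wN]].
have ww' x : ~ N x -> w x = w' x by move=> Nx; apply: contrapT => h; exact/Nx/wN.
exists (w \_ (~` N)); split.
- rewrite (_ : w \_ _ = w' \_ (~` N)).
    by apply/(measurable_restrictT w' (measurableC mN)); exact: measurable_funTS.
  apply/funext => x; rewrite /patch; case: ifPn => //.
  by rewrite inE => /ww'.
- by move=> x; rewrite /patch; case: ifPn.
- by move=> x; rewrite /patch; case: ifPn.
- exists N; split => // x /= h; apply: contrapT => Nx; apply: h.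
  by rewrite patchT// inE.
- move=> A mA; rewrite /density; set v := w \_ _.
  have v0 x : 0 <= v x by rewrite /v /patch; case: ifPn.
  have vw x : v x <= w x by rewrite /v /patch; case: ifPn.
  rewrite !ge0_integralE; [|by move=> x _; rewrite lee_fin..].
  apply/eqP; rewrite eq_le; apply/andP; split; apply: ub_ereal_sup.
    move=> _ [h /= hw <-].
    pose h' := h \* (indic_nnsfun R (measurableC mN)).
    have -> : sintegral m h = sintegral m h'.
      rewrite -!integralT_nnsfun; apply: ae_eq_integral => //.
      + exact/measurable_EFinP.
      + exact/measurable_EFinP.
      + exists N; split => // x /= /not_implyP[_ hx].
        apply: contrapT => Nx; apply: hx => /=.
        by rewrite mindicE mem_set// mulr1.
    apply: ereal_sup_ubound; exists h' => //= x.
    rewrite /= mindicE /v; have [Nx|Nx] := pselect (N x).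
      rewrite memNset/= ?mulr0; last by move=> /(_ Nx).
      by rewrite erestrict_ge0// => y _; rewrite lee_fin.
    rewrite mem_set// mulr1 (le_trans (hw x))// /patch; case: ifPn => // _.
    by rewrite mem_set.
move=> _ [h /= hw <-]; apply: ereal_sup_ubound; exists h => //= x.
rewrite (le_trans (hw x))// /patch; case: ifPn => // _.
by rewrite lee_fin vw.
Qed.

(** * Borel sets and continuity in spaces of row vectors *)

(** The sigma-algebra on a product is generated by measurable rectangles, not by open sets. A
    countable base of measurable sets makes open sets measurable there too, and hence continuous
    functions. *)
Definition measurable_base d (T : topologicalMeasurableType d)
    (B : nat -> set T) :=
  (forall i, measurable (B i)) /\
  (forall U x, open U -> U x -> exists2 i, B i x & B i `<=` U).

Lemma open_bigcup_base d (T : topologicalMeasurableType d) (B : nat -> set T)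
    (U : set T) : measurable_base B -> open U ->
  U = \bigcup_(i in [set i | B i `<=` U]) B i.
Proof.
move=> [_ bB] oU; apply/seteqP; split => [x Ux|x [i /= BU Bx]]; last exact: BU.
by have [i Bix BiU] := bB _ _ oU Ux; exists i.
Qed.

Lemma measurable_base_open d (T : topologicalMeasurableType d)
    (B : nat -> set T) (U : set T) :
  measurable_base B -> open U -> measurable U.
Proof.
move=> bB oU; rewrite (open_bigcup_base bB oU).
by apply: bigcup_measurable => i _; exact: bB.1.
Qed.

Lemma measurable_base_prod d1 d2 (T1 : topologicalMeasurableType d1)
    (T2 : topologicalMeasurableType d2) (B1 : nat -> set T1)
    (B2 : nat -> set T2) :
  measurable_base B1 -> measurable_base B2 ->
  exists B : nat -> set (T1 * T2)%type, measurable_base B.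
Proof.
move=> [mB1 b1] [mB2 b2].
exists (fun k => if unpickle k is Some (i, j) then B1 i `*` B2 j else set0).
split=> [k|U [x y] oU Uxy].
  by case: unpickle => [[i j]|//]; exact: measurableX.
have [[V1 V2] /= [V1x V2y] V12U] : nbhs (x, y) U by exact: open_nbhs_nbhs.
move: V1x V2y; rewrite !nbhsE => -[W1 [oW1 W1x] WV1] [W2 [oW2 W2y] WV2].
have [i ix iW] := b1 _ _ oW1 W1x; have [j jy jW] := b2 _ _ oW2 W2y.
exists (pickle (i, j)); rewrite pickleK//.
by move=> [u v] [/= /iW/WV1 ? /jW/WV2 ?]; exact: V12U.
Qed.

Section row_vectors.
Context (R : realType).

Definition rational_ball n (k : nat) : set 'rV[R]_n :=
  if unpickle k is Some (q, r) then
    ball (\row_i ratr ((q : 'rV[rat]_n) ord0 i) : 'rV[R]_n) (r : nat).+1%:R^-1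
  else set0.

Lemma rational_ball_base n : measurable_base (@rational_ball n).
Proof.
split=> [k|U x oU Ux]; rewrite /rational_ball.
  case: unpickle => [[q r]|//]; apply: sub_sigma_algebra.
  by apply: ball_open; rewrite invr_gt0 ltr0n.
have /nbhs_ballP[e /= e0 eU] : nbhs x U by exact: open_nbhs_nbhs.
have [r re] : exists r : nat, r.+1%:R^-1 < e / 2 :> R.
  exists (Num.truncn ((e / 2)^-1)).
  by rewrite invf_plt ?posrE ?divr_gt0 ?ltr0n//; exact: truncnS_gt.
have r0 : 0 < r.+1%:R^-1 :> R by rewrite invr_gt0 ltr0n.
have /choice[q qx] : forall i, exists q : rat,
    ratr q \in `]x ord0 i - r.+1%:R^-1, x ord0 i + r.+1%:R^-1[.
  by move=> i; apply: rat_in_itvoo; rewrite ltrD2l gtrN.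
have xq : ball (\row_i ratr (q i) : 'rV[R]_n) r.+1%:R^-1 x.
  split=> // i j; rewrite ord1 !mxE /ball/= ltr_distlC.
  move: (qx j); rewrite in_itv/= => /andP[? ?]; apply/andP.
  by split; [rewrite ltrBlDr|rewrite -ltrBlDr].
have qE : (\row_i ratr ((\row_i q i) ord0 i) : 'rV[R]_n) = \row_i ratr (q i).
  by apply/rowP => i; rewrite !mxE.
exists (pickle (\row_i q i, r)); rewrite pickleK// qE// => y qy.
apply: eU; apply: (@le_ball _ _ _ (r.+1%:R^-1 + r.+1%:R^-1)).
  by rewrite (splitr e) lerD // ltW.
by apply: ball_triangle qy; exact: ball_sym.
Qed.

Lemma continuous_measurable_base d (T : topologicalMeasurableType d)
    (B : nat -> set T) (f : T -> R) :
  measurable_base B -> continuous f -> measurable_fun setT f.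
Proof.
move=> bB /continuousP cf.
apply: (measurability _ (RGenOInfty.measurableE R)) => _ [_ [x ->] <-].
by rewrite setTI; apply: (measurable_base_open bB); apply: cf; exact: interval_open.
Qed.

Lemma continuous_measurable_base_rV d (T : topologicalMeasurableType d)
    (B : nat -> set T) n (f : T -> 'rV[R]_n) :
  measurable_base B -> continuous f -> measurable_fun setT f.
Proof.
move=> bB /continuousP cf.
apply: (@measurability _ _ _ _ _ _ (@open 'rV[R]_n)) => // _ [A oA <-].
by rewrite setTI; apply: (measurable_base_open bB); exact: cf.
Qed.

Lemma measurable_fun_coord n (i : 'I_n) :
  measurable_fun setT (fun x : 'rV[R]_n => x ord0 i).
Proof.
apply: (continuous_measurable_base (rational_ball_base n)).
exact: coord_continuous.
Qed.

(** Balls of the sup norm are boxes, so the preimage of a rational ball is a finite intersection of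
    coordinate preimages. *)
Lemma measurable_fun_rV d (T : measurableType d) n (f : T -> 'rV[R]_n) :
  (forall i, measurable_fun setT (fun x => f x ord0 i)) ->
  measurable_fun setT f.
Proof.
move=> mf; apply: (@measurability _ _ _ _ _ _ (@open 'rV[R]_n)) => // _ [A oA <-].
rewrite setTI (open_bigcup_base (rational_ball_base n) oA) preimage_bigcup.
apply: bigcup_measurable => k _; rewrite /rational_ball.
case: unpickle => [[q r]|]; last by rewrite preimage_set0.
set c := (X in ball X); set e := (X in ball _ X).
have e0 : 0 < e by rewrite invr_gt0 ltr0n.
have -> : f @^-1` ball c e =
    \bigcap_(i in [set: 'I_n]) ((fun x => f x ord0 i) @^-1` ball (c ord0 i) e).
  apply/seteqP; split => x; first by move=> [_ fx] i _; exact: fx.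
  by move=> fx; split=> // i j; rewrite ord1; exact: fx.
apply: fin_bigcap_measurable => // i _; rewrite -[X in measurable X]setTI.
by apply: mf => //; exact: measurable_ball.
Qed.

End row_vectors.

(* Unlike [cvgD] and the like, these apply when the source is a space of
   matrices, whose neighbourhood filters get unfolded during unification. *)
Lemma continuous_idf (T : topologicalType) : continuous (fun x : T => x).
Proof. by move=> x. Qed.

Lemma continuous_compf (T U V : topologicalType) (f : T -> U) (g : U -> V) :
  continuous f -> continuous g -> continuous (fun x => g (f x)).
Proof. by move=> cf cg x; apply: continuous_comp; [exact: cf|exact: cg]. Qed.

Section continuous_arithmetic.
Context (K : numFieldType) (V : normedModType K) (T : topologicalType).
Implicit Types (f g : T -> V) (k : T -> K).

Lemma continuous_addf f g :
  continuous f -> continuous g -> continuous (fun x => f x + g x).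
Proof. by move=> cf cg x; apply: cvgD; [exact: cf|exact: cg]. Qed.

Lemma continuous_oppf f : continuous f -> continuous (fun x => - f x).
Proof. by move=> cf x; apply: cvgN; exact: cf. Qed.

Lemma continuous_subf f g :
  continuous f -> continuous g -> continuous (fun x => f x - g x).
Proof. by move=> cf cg; apply: continuous_addf => //; exact: continuous_oppf. Qed.

Lemma continuous_scalef k f :
  continuous k -> continuous f -> continuous (fun x => k x *: f x).
Proof. by move=> ck cf x; apply: cvgZ; [exact: ck|exact: cf]. Qed.

Lemma continuous_sumf (I : Type) (r : seq I) (F : I -> T -> V) :
  (forall i, continuous (F i)) -> continuous (fun x => \sum_(i <- r) F i x).
Proof.
move=> cF; elim: r => [|i r IH].
  rewrite (_ : (fun _ => _) = cst 0); first by move=> x; exact: cvg_cst.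
  by apply/funext => x; rewrite big_nil.
rewrite (_ : (fun _ => _) = fun x => F i x + \sum_(i <- r) F i x).
  exact: continuous_addf.
by apply/funext => x; rewrite big_cons.
Qed.

End continuous_arithmetic.

(** * Lebesgue measure and translation-invariant measures *)

Lemma pushforward_measureP d1 d2 (T1 : measurableType d1)
    (T2 : measurableType d2) (R : realType) (m : {measure set T1 -> \bar R})
    (f : T1 -> T2) :
  measurable_fun setT f ->
  exists nu : {measure set T2 -> \bar R}, forall A, nu A = m (f @^-1` A).
Proof. by move=> mf; unshelve eexists (pushforward m f). Qed.

Section lebesgue_row.
Context (R : realType).

Lemma lebesgue_measure_shift (v : R) (A : set R) : measurable A ->
  lebesgue_measure ((fun x => x + v) @^-1` A) = lebesgue_measure A.
Proof.
move=> mA.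
have mf : measurable_fun setT (fun x : measurableTypeR R => (x + v : measurableTypeR R)).
  exact: measurable_funD.
have [nu nuE] := pushforward_measureP (@lebesgue_measure R) mf.
rewrite -[LHS]nuE; apply/esym/lebesgue_measure_unique => //= _ [[a b]] _ <-.
rewrite nuE /=.
have -> : (fun x => x + v) @^-1` `]a, b] = `]a - v, b - v]%classic.
  by apply/seteqP; split => x /=; rewrite !in_itv/= ltrBlDr lerBrDr.
rewrite !lebesgue_measure_itv/= !lte_fin ltrD2r; case: ifPn => // _.
by rewrite -!EFinD; congr EFin; ring.
Qed.

(** Cubes with integer [k] exhaust the space by compact sets and give sigma-finiteness throughout;
    the cube with [k = 1] is the reference set that fixes the constants of proportionality. *)
Definition cube n (k : R) : set 'rV[R]_n := [set x | forall i, `|x ord0 i| <= k].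

Lemma measurable_cube n k : measurable (@cube n k).
Proof.
have -> : @cube n k = \bigcap_(i in [set: 'I_n])
    ((fun x : 'rV_n => x ord0 i) @^-1` [set y | `|y| <= k]).
  by apply/seteqP; split => x; [move=> xk i _; exact: xk|move=> xk i; exact: xk].
apply: fin_bigcap_measurable => // i _; rewrite -[X in measurable X]setTI.
apply: measurable_fun_coord => //.
rewrite (_ : [set y | _] = `[- k, k]%classic); first exact: measurable_itv.
by apply/seteqP; split => y /=; rewrite in_itv/= ler_norml.
Qed.

Lemma bigcup_cube n : \bigcup_(k : nat) @cube n k%:R = setT.
Proof.
apply/seteqP; split => // x _.
exists (Num.truncn `|x|).+1 => // i /=.
rewrite (le_trans _ (ltW (truncnS_gt _)))//.
by rewrite /Num.norm/= mx_normrE (le_trans _ (le_bigmax _ _ (ord0, i))).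
Qed.

Lemma measurable_row_mx n :
  measurable_fun setT (fun p : measurableTypeR R * 'rV[R]_n =>
    row_mx (p.1)%:M p.2 : 'rV[R]_(1 + n)).
Proof.
apply: measurable_fun_rV => i.
rewrite (_ : (fun _ => _) = fun p : measurableTypeR R * 'rV[R]_n =>
  match fintype.split i with inl j => p.1 | inr j => p.2 ord0 j end); last first.
  apply/funext => p; rewrite mxE; case: fintype.split => j //.
  by rewrite (ord1 j) mxE eqxx.
case: fintype.split => j; first exact: measurable_fst.
by apply: (measurableT_comp (measurable_fun_coord j)); exact: measurable_snd.
Qed.

(** These three properties are all that the proof uses of Lebesgue measure on row vectors. The
    induction follows the iterated product in [lebesgue]. *)
Lemma lebesgue_row n : exists nu : {sigma_finite_measure set 'rV[R]_n -> \bar R},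
  [/\ forall A, measurable A -> lebesgue A = nu A,
      forall (v : 'rV[R]_n) A, measurable A -> nu ((fun x => x + v) @^-1` A) = nu A &
      forall k : R, 0 <= k -> nu (@cube n k) = ((k *+ 2) ^+ n)%:E].
Proof.
elim: n => [|n [nu [nuE nuD nuC]]].
  have d0 (A B : set 'rV[R]_0) : (A 0 <-> B 0) ->
      dirac (0 : 'rV[R]_0) A = dirac (0 : 'rV[R]_0) B :> \bar R.
    move=> AB; rewrite !diracE; congr (_%:R%:E).
    by congr nat_of_bool; apply/idP/idP; rewrite !inE => /AB.
  have [nu nuE] : exists m' : {sigma_finite_measure set 'rV[R]_0 -> \bar R},
      forall A, m' A = dirac (0 : 'rV[R]_0) A.
    apply: (@sigma_finite_measureP _ _ _ (dirac (0 : 'rV[R]_0))).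
    exists (fun=> setT); first by rewrite bigcup_const.
    by move=> _; split; [exact: measurableT|rewrite /= diracE ltry].
  exists nu; split => [A _|v A _|k k0]; rewrite !nuE //.
    by apply: d0; rewrite /preimage/= (_ : 0 + v = 0)//; apply/rowP; case.
  by rewrite expr0 diracE mem_set// => -[].
have [nu1 nu1E] := pushforward_measureP (lebesgue_measure \x nu)%E
  (@measurable_row_mx n).
have lebE A : measurable A -> lebesgue A = nu1 A.
  move=> mA; rewrite nu1E /= /pushforward; apply: product_measure1_eq => //.
  by rewrite -[X in measurable X]setTI; exact: measurable_row_mx.
have cubeE k : (fun p : measurableTypeR R * 'rV[R]_n =>
    row_mx (p.1)%:M p.2 : 'rV[R]_(1 + n)) @^-1` (@cube (1 + n) k) =
    `[- k, k]%classic `*` @cube n k.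
  apply/seteqP; split => [[x y] /= xyk|[x y] /= [xk yk] i].
    split => [|i].
      have := xyk (lshift n ord0).
      by rewrite row_mxEl mxE eqxx in_itv/= ler_norml.
    by have := xyk (rshift 1 i); rewrite row_mxEr.
  rewrite mxE; case: fintype.split => j; last exact: yk.
  by rewrite (ord1 j) mxE eqxx mulr1n ler_norml.
have nu1C (k : R) : 0 <= k -> nu1 (cube k) = ((k *+ 2) ^+ n.+1)%:E.
  move=> k0; rewrite nu1E cubeE.
  transitivity ((@lebesgue_measure R `[(- k)%R, k]%classic * nu (@cube n k))%E).
    by apply: product_measure1E; [exact: measurable_itv|exact: measurable_cube].
  rewrite nuC// lebesgue_measure_itv/= lte_fin exprS EFinM; congr (_ * _)%E.
  rewrite -EFinD opprK -mulr2n; case: ltP => // kk; congr EFin.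
  have -> : k = 0 by lra.
  by rewrite mul0rn.
have [nu2 nu2E] : exists m' : {sigma_finite_measure set 'rV[R]_(1 + n) -> \bar R},
    forall A, m' A = nu1 A.
  apply: sigma_finite_measureP; exists (fun k => @cube (1 + n) k%:R).
    by rewrite bigcup_cube.
  by move=> k; split; [exact: measurable_cube|rewrite nu1C// ltry].
exists nu2; split => [A mA|v A mA|k k0]; rewrite !nu2E ?lebE ?nu1C//.
rewrite !nu1E.
set phi := fun p : measurableTypeR R * 'rV[R]_n => _.
have mphiA : measurable (phi @^-1` A).
  by rewrite -[X in measurable X]setTI; exact: measurable_row_mx.
(* Under the identification [phi] of R x R^n with R^(1+n), translation by [v] becomes a translation
   in each factor, so invariance needs checking on rectangles only. *)
have -> : phi @^-1` ((fun x => x + v) @^-1` A) =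
    (fun p : measurableTypeR R * 'rV[R]_n =>
      (p.1 + v ord0 (lshift n (ord0 : 'I_1) : 'I_(1 + n)) : measurableTypeR R,
       p.2 + \row_j v ord0 (rshift 1 j : 'I_(1 + n)))) @^-1` (phi @^-1` A).
  rewrite -comp_preimage; congr (preimage _ A); apply/funext => -[x y] /=.
  rewrite /phi/=; apply/rowP => i; rewrite !mxE.
  case: (@fintype.splitP 1 n i) => j ij.
    rewrite !(ord1 j) !mxE eqxx !mulr1n; congr (_ + v _ _).
    by apply/val_inj; rewrite /= ij (ord1 j).
  by rewrite !mxE; congr (_ + v _ _); apply/val_inj; rewrite /= ij.
set t1 := v _ _; set t2 := \row_j _.
have mt : measurable_fun setT (fun p : measurableTypeR R * 'rV[R]_n =>
    (p.1 + t1 : measurableTypeR R, p.2 + t2)).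
  apply/measurable_fun_pairP; split.
    by apply: measurable_funD => //; exact: measurable_fst.
  apply: measurable_fun_rV => i.
  rewrite (_ : (fun _ => _) = fun p : measurableTypeR R * 'rV[R]_n =>
    p.2 ord0 i + t2 ord0 i); last by apply/funext => p; rewrite mxE.
  apply: measurable_funD => //.
  by apply: (measurableT_comp (measurable_fun_coord i)); exact: measurable_snd.
have [m mE] := pushforward_measureP (lebesgue_measure \x nu)%E mt.
rewrite -mE; apply/esym/product_measure_unique => //.
move=> B C mB mC; rewrite mE.
transitivity ((lebesgue_measure \x nu)%E
    (((fun x => x + t1) @^-1` B) `*` ((fun x => x + t2) @^-1` C))) => //.
rewrite product_measure1E; last 2 first.
- rewrite -[X in measurable X]setTI; apply: measurable_funD => //.
- rewrite -[X in measurable X]setTI.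
  apply: measurable_fun_rV => // i.
  rewrite (_ : (fun _ => _) = fun p : 'rV[R]_n => p ord0 i + t2 ord0 i).
    by apply: measurable_funD => //; exact: measurable_fun_coord.
  by apply/funext => p; rewrite mxE.
by congr (_ * _)%E; [exact: lebesgue_measure_shift|exact: nuD].
Qed.

End lebesgue_row.

Section translation_invariant.
Context (R : realType) (n : nat).
Local Notation Z := 'rV[R]_n.

Definition translation_invariant (m : set Z -> \bar R) :=
  forall (v : Z) A, measurable A -> m ((fun x => x + v) @^-1` A) = m A.

Lemma continuous_measurable_rV2 (f : Z * Z -> Z) :
  continuous f -> measurable_fun setT f.
Proof.
have [B bB] := measurable_base_prod (rational_ball_base R n) (rational_ball_base R n).
exact: continuous_measurable_base_rV bB.
Qed.

Lemma measurable_addrV (v : Z) : measurable_fun setT (fun x : Z => x + v).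
Proof.
apply: (continuous_measurable_base_rV (rational_ball_base R n)).
apply: continuous_addf; first exact: continuous_idf.
exact: cst_continuous.
Qed.

Lemma measurable_opprV : measurable_fun setT (fun x : Z => - x).
Proof.
apply: (continuous_measurable_base_rV (rational_ball_base R n)).
by apply: continuous_oppf ; exact: continuous_idf.
Qed.

Local Open Scope ereal_scope.

Lemma product_section_swap (mu nu : {sigma_finite_measure set Z -> \bar R})
    (S : set (Z * Z)) : measurable S ->
  \int[mu]_x nu (xsection S x) = \int[nu]_y mu (ysection S y).
Proof.
move=> mS; have := indic_fubini_tonelli mu nu mS.
rewrite (indic_fubini_tonelli_FE nu mS) (indic_fubini_tonelli_GE mu mS).
exact.
Qed.

(** Both sides are the mass of [S1], the pairs (x, y) with x in A and x + y in B. Its section at x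
    in A is a translate of B, which gives the left side. With the order exchanged, translating x by
    y turns [S1] into [S2], whose section at x in B is a translate of -A. *)
Lemma translation_invariant_reflect
    (mu nu : {sigma_finite_measure set Z -> \bar R}) A B :
  translation_invariant mu -> translation_invariant nu ->
  measurable A -> measurable B ->
  mu A * nu B = mu B * nu (-%R @^-1` A).
Proof.
move=> muD nuD mA mB.
have mNA : measurable (-%R @^-1` A).
  by rewrite -[X in measurable X]setTI; exact: measurable_opprV.
pose S1 : set (Z * Z) := [set p | A p.1 /\ B (p.1 + p.2)%R].
pose S2 : set (Z * Z) := [set p | A (p.1 - p.2)%R /\ B p.1].
have mpre (f : Z * Z -> Z) C : continuous f -> measurable C ->
    measurable (f @^-1` C).
  move=> cf mC; rewrite -[X in measurable X]setTI.
  exact: continuous_measurable_rV2.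
have mS1 : measurable S1.
  apply: measurableI; first by apply: mpre mA => x; exact: cvg_fst.
  by apply: mpre mB; apply: continuous_addf => x; [exact: cvg_fst|exact: cvg_snd].
have mS2 : measurable S2.
  apply: measurableI; last by apply: mpre mB => x; exact: cvg_fst.
  by apply: mpre mA; apply: continuous_subf => x; [exact: cvg_fst|exact: cvg_snd].
transitivity (\int[mu]_x nu (xsection S1 x)).
  under eq_integral => x _.
    rewrite (_ : nu _ = (\1_A x)%:E * nu B); first over.
    have [xA|xA] := pselect (A x).
      rewrite indicE mem_set// mul1e -(nuD x B)//; congr (nu _).
      apply/seteqP; split => y; rewrite /xsection/= inE /S1/= addrC.
        by case.
      by [].
    rewrite indicE memNset// mul0e (_ : xsection _ _ = set0) ?measure0//.
    by apply/seteqP; split => y //; rewrite /xsection/= inE /S1/= => -[].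
  by rewrite ge0_integralZr// ?integral_indic ?setIT//; exact/measurable_EFinP.
rewrite product_section_swap//.
transitivity (\int[nu]_y mu (ysection S2 y)).
  apply: eq_integral => y _; rewrite -[RHS](muD y); last exact: measurable_ysection.
  congr (mu _); apply/seteqP; split => x; rewrite /ysection/= !inE /S1 /S2/= addrK//.
rewrite -product_section_swap//.
under eq_integral => x _.
  rewrite (_ : nu _ = (\1_B x)%:E * nu (-%R @^-1` A)); first over.
  have [xB|xB] := pselect (B x).
    rewrite indicE mem_set// mul1e -(nuD (- x)%R _ mNA)//; congr (nu _).
    apply/seteqP; split => y; rewrite /xsection/= inE /S2/= opprB addrC.
      by case.
    by [].
  rewrite indicE memNset// mul0e (_ : xsection _ _ = set0) ?measure0//.
  by apply/seteqP; split => y //; rewrite /xsection/= inE /S2/= => -[].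
by rewrite ge0_integralZr// ?integral_indic ?setIT//; exact/measurable_EFinP.
Qed.

(* A translation-invariant measure is a multiple of any other one; applied with
   the same measure twice, the reflection identity shows that it is even. *)
Lemma translation_invariant_unique
    (mu nu : {sigma_finite_measure set Z -> \bar R}) A B C :
  translation_invariant mu -> translation_invariant nu ->
  measurable A -> measurable B -> measurable C -> 0 < nu C -> nu C < +oo ->
  mu A * nu B = mu B * nu A.
Proof.
move=> muD nuD mA mB mC C0 Coo.
rewrite (translation_invariant_reflect muD nuD mA mB); congr (_ * _).
have Cfin : nu C \is a fin_num by rewrite ge0_fin_numE// ltW.
have := translation_invariant_reflect nuD nuD mA mC.
rewrite muleC => /eqP; rewrite eq_le !lee_pmul2l// => /andP[? ?].
by apply/eqP; rewrite eq_le; apply/andP; split.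
Qed.

End translation_invariant.

(** * Hausdorff measure under Lipschitz maps *)

Section hausdorff_outer.
Local Open Scope ereal_scope.

Lemma lebesgue_ge0 (R : realType) n (A : set 'rV[R]_n) : 0 <= lebesgue A.
Proof.
elim: n A => [|n IH] A /=; first exact: measure_ge0.
by apply: integral_ge0 => x _; exact: IH.
Qed.

Lemma diam_ge0 (R : realType) (V : zmodType) (nrm : V -> R) (A : set V) : 0 <= diam nrm A.
Proof. by rewrite /diam le_max lexx. Qed.

Lemma hausdorff_size_ge0 (R : realType) (V : zmodType) (nrm : V -> R) k
    (B : set V) : 0 <= hausdorff_size nrm k B.
Proof.
rewrite /hausdorff_size; case: ifPn => // _.
by rewrite mule_ge0 ?lebesgue_ge0// expe_ge0// mule_ge0 ?diam_ge0// lee_fin.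
Qed.

Section hausdorff_lipschitz.
Context (R : realType) (V W : zmodType) (nrmV : V -> R) (nrmW : W -> R).

Lemma diam_image_le (phi : V -> W) (A B : set V) (c : R) : (0 < c)%R ->
  (forall x y, A x -> A y -> (nrmW (phi x - phi y) <= c * nrmV (x - y))%R) ->
  diam nrmW (phi @` (B `&` A)) <= c%:E * diam nrmV B.
Proof.
move=> c0 cA; rewrite {1}/diam ge_max; apply/andP; split.
  by rewrite mule_ge0 ?diam_ge0// lee_fin ltW.
apply: ub_ereal_sup => _ [_ [x [Bx Ax] <-] [_ [y [By Ay] <-] <-]].
apply: (@le_trans _ _ (c%:E * (nrmV (x - y))%:E)).
  by rewrite -EFinM lee_fin; exact: cA.
rewrite lee_pmul2l// /diam le_max; apply/orP; right.
by apply: ereal_sup_ubound; exists x => //; exists y.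
Qed.

Lemma expeMl (c : R) (x : \bar R) k : (0 <= c)%R -> 0 <= x ->
  (c%:E * x) ^+ k = (c ^+ k)%:E * x ^+ k.
Proof.
move=> c0 x0; elim: k => [|k IH]; first by rewrite !expe0 expr0 mul1e.
by rewrite !expeS IH exprS EFinM muleACA.
Qed.

Lemma lee_expe (x y : \bar R) k : 0 <= x -> x <= y -> x ^+ k <= y ^+ k.
Proof.
move=> x0 xy; elim: k => [|k IH]; first by rewrite !expe0.
by rewrite !expeS; apply: lee_pmul => //; exact: expe_ge0.
Qed.

Lemma hausdorff_size_image_le k (phi : V -> W) (A B : set V) (c : R) :
  (0 < c)%R ->
  (forall x y, A x -> A y -> (nrmW (phi x - phi y) <= c * nrmV (x - y))%R) ->
  hausdorff_size nrmW k (phi @` (B `&` A)) <=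
  (c ^+ k)%:E * hausdorff_size nrmV k B.
Proof.
move=> c0 cA; have ck : (0 <= c ^+ k)%R by rewrite exprn_ge0// ltW.
rewrite {1}/hausdorff_size; case: ifPn => [_|BA0].
  by rewrite mule_ge0 ?hausdorff_size_ge0// lee_fin.
rewrite /hausdorff_size ifF; last first.
  apply/negP => /eqP B0; move: BA0; rewrite B0 set0I image_set0 eqxx//.
rewrite muleCA lee_wpmul2l ?lebesgue_ge0//.
rewrite -expeMl ?(ltW c0)//; last by rewrite mule_ge0 ?diam_ge0// lee_fin.
apply: lee_expe.
  by rewrite mule_ge0 ?lee_fin// /diam le_max lexx.
by rewrite muleCA lee_wpmul2l ?lee_fin//; exact: diam_image_le.
Qed.

(** A cover of [A] at scale [delta / c] is carried to a cover of the image at scale [delta]. Its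
    members are first cut down to [A], the only place where the Lipschitz bound is available. *)
Lemma hausdorff_image_le k (phi : V -> W) (A : set V) (c : R) : (0 < c)%R ->
  (forall x y, A x -> A y -> (nrmW (phi x - phi y) <= c * nrmV (x - y))%R) ->
  hausdorff nrmW k (phi @` A) <= (c ^+ k)%:E * hausdorff nrmV k A.
Proof.
move=> c0 cA; have ck : (0 < c ^+ k)%R by rewrite exprn_gt0.
apply: ub_ereal_sup => _ [delta /= delta0 <-].
apply: (@le_trans _ _ ((c ^+ k)%:E * hausdorff_content nrmV k (delta / c) A)).
  rewrite -lee_pdivrMl//; apply: le_ereal_inf_tmp => _ [U [dU AU] <-].
  rewrite lee_pdivrMl// -nneseriesZl; last by move=> i _; exact: hausdorff_size_ge0.
  apply: (@le_trans _ _ (\sum_(0 <= i <oo)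
      hausdorff_size nrmW k (phi @` (U i `&` A)))).
    apply: ereal_inf_lbound; exists (fun i => phi @` (U i `&` A)) => //; split.
      move=> i; apply: (le_trans (diam_image_le (U i) c0 cA)).
      by rewrite -lee_pdivlMl//  (le_trans (dU i))// -EFinM mulrC.
    move=> _ [x Ax <-]; have [i _ Uix] := AU _ Ax.
    by exists i => //; exists x.
  apply: lee_nneseries => i *; first exact: hausdorff_size_ge0.
  exact: hausdorff_size_image_le.
rewrite lee_pmul2l//; apply: ereal_sup_ubound; exists (delta / c)%R => //=.
by rewrite divr_gt0.
Qed.

End hausdorff_lipschitz.

End hausdorff_outer.

(** * Orthonormal bases and orthogonal projections *)

Section dot_geometry.
Context (R : realType) (n : nat) (dot : {dot 'rV[R]_n for idfun}).
Local Notation Z := 'rV[R]_n.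
Implicit Types (x y : Z).

Lemma dotC x y : dot x y = dot y x.
Proof. by rewrite hermC expr0 mul1r. Qed.

Lemma dot_ge0 x : 0 <= dot x x.
Proof. by have [->|/neq0_dnorm_gt0/ltW] := eqVneq x 0; rewrite ?linear0l. Qed.

Lemma dot_eq0 x : dot x x = 0 -> x = 0.
Proof.
move=> x0; apply/eqP; apply/negPn/negP => /(neq0_dnorm_gt0 (s := dot)).
by rewrite x0 ltxx.
Qed.

Lemma sqr_dnorm x : dnorm dot x ^+ 2 = dot x x.
Proof. by rewrite sqr_sqrtr// dot_ge0. Qed.

Lemma dotZl (c : R) x y : dot (c *: x) y = c * dot x y.
Proof. by rewrite linearZl_LR. Qed.

Lemma dotZr (c : R) x y : dot x (c *: y) = c * dot x y.
Proof. by rewrite dotC dotZl dotC. Qed.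

Lemma dotDl x y z : dot (x + y) z = dot x z + dot y z.
Proof. exact: linearDl. Qed.

Lemma dotDr x y z : dot x (y + z) = dot x y + dot x z.
Proof. exact: linearDr. Qed.

Lemma dotBl x y z : dot (x - y) z = dot x z - dot y z.
Proof. exact: linearBl. Qed.

Lemma dot_sumr x (I : Type) (r : seq I) (F : I -> Z) :
  dot x (\sum_(i <- r) F i) = \sum_(i <- r) dot x (F i).
Proof. exact: linear_sumr. Qed.

Lemma dot_suml x (I : Type) (r : seq I) (F : I -> Z) :
  dot (\sum_(i <- r) F i) x = \sum_(i <- r) dot (F i) x.
Proof. by rewrite dotC dot_sumr; apply: eq_bigr => i _; exact: dotC. Qed.

Lemma dnormZ (c : R) x : dnorm dot (c *: x) = `|c| * dnorm dot x.
Proof.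
by rewrite /dnorm dotZl dotZr mulrA -expr2 sqrtrM ?sqr_ge0// sqrtr_sqr.
Qed.

Lemma continuous_dotl y : continuous (fun x => dot x y).
Proof.
rewrite (_ : (fun _ => _) =
    fun x : Z => \sum_(i < n) (x ord0 i *: (dot (delta_mx ord0 i) y : R^o))).
  apply: (@continuous_sumf _ R^o) => i; apply: (@continuous_scalef _ R^o).
    exact: coord_continuous.
  exact: cst_continuous.
apply/funext => x; rewrite {1}(row_sum_delta x) dot_suml.
by apply: eq_bigr => i _; rewrite dotZl.
Qed.

Lemma continuous_dnorm : continuous (dnorm dot).
Proof.
move=> x; apply: continuous_comp; last exact: sqrt_continuous.
suff: continuous (fun x => dot x x) by exact.
rewrite (_ : (fun _ => _) =
    fun x : Z => \sum_(i < n) (x ord0 i *: (dot x (delta_mx ord0 i) : R^o))).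
  apply: (@continuous_sumf _ R^o) => i; apply: (@continuous_scalef _ R^o).
    exact: coord_continuous.
  exact: continuous_dotl.
apply/funext => {}x; rewrite {2}(row_sum_delta x) dot_sumr.
by apply: eq_bigr => i _; rewrite dotZr.
Qed.

Definition orthonormal_family k (e : 'I_k -> Z) :=
  forall i j, dot (e i) (e j) = (i == j)%:R.

(** For orthonormal [e], this is the orthogonal projection onto the span of [e] followed by the
    linear map sending each [e i] to [f i]. With [f = e] it is the projection itself. *)
Definition transport k (e f : 'I_k -> Z) x := \sum_i dot x (e i) *: f i.

(** Gram-Schmidt by induction on the dimension: normalise one vector and pass to its orthogonal
    complement inside [V]. Spanning is stated as invariance under the projection, the form used
    later. *)
Lemma orthonormal_basis (V : {vspace Z}) : exists e : 'I_(\dim V) -> Z,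
  [/\ forall i, e i \in V, orthonormal_family e &
      forall x, x \in V -> transport e e x = x].
Proof.
move: {2}(\dim V) (erefl (\dim V)) => k; elim: k V => [|k IH] V dV.
  rewrite dV; exists (fun=> 0); split=> [[]|[]|x]//.
  move/eqP: dV; rewrite dimv_eq0 => /eqP ->; rewrite memv0 => /eqP ->.
  by rewrite /transport big_ord0.
have V0 : V != 0%VS by rewrite -dimv_eq0 dV.
pose v := vpick V; have v0 : v != 0 by rewrite vpick0.
have dv0 : 0 < dot v v by exact: neq0_dnorm_gt0.
pose e1 := (dnorm dot v)^-1 *: v.
have e1V : e1 \in V by rewrite memvZ// memv_pick.
have e11 : dot e1 e1 = 1.
  rewrite dotZl dotZr mulrA -expr2 exprVn sqr_dnorm mulVf// gt_eqF//.
pose V' := (V :&: orthov dot <[e1]>)%VS.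
have dV' : \dim V' = k.
  rewrite /V' -eq_dim_orthov1 ?dV//; apply/mem_orthovPn; exists e1 => //.
  apply/eqP => h; have := @oner_neq0 R; rewrite -e11.
  by move/eqP; apply; exact: h.
have [e' [e'V e'O e'x]] := IH V' dV'.
have V'V x : x \in V' -> x \in V /\ dot x e1 = 0.
  by rewrite memv_cap mem_orthov1 => /andP[-> /eqP].
rewrite dV' in e' e'V e'O e'x; rewrite dV.
exists (fun i => if unlift ord0 i is Some j then e' j else e1); split.
- by move=> i; case: unliftP => [j _|_//]; have [] := V'V _ (e'V j).
- move=> i j; case: unliftP => [i' ->|->]; case: unliftP => [j' ->|->].
  + by rewrite e'O (inj_eq lift_inj).
  + by have [_ ->] := V'V _ (e'V i'); rewrite eq_sym (negbTE (neq_lift _ _)).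
  + by rewrite dotC; have [_ ->] := V'V _ (e'V j'); rewrite (negbTE (neq_lift _ _)).
  + by rewrite e11 eqxx.
move=> x xV; rewrite /transport big_ord_recl unlift_none.
have xV' : x - dot x e1 *: e1 \in V'.
  have x1 : dot (x - dot x e1 *: e1) e1 = 0 by rewrite dotBl dotZl e11 mulr1 subrr.
  rewrite memv_cap mem_orthov1; apply/andP; split; last exact/eqP/x1.
  by rewrite rpredB// memvZ.
rewrite -[RHS](subrK (dot x e1 *: e1)) addrC; congr (_ + _).
rewrite -[RHS]e'x//; apply: eq_bigr => i _; rewrite liftK dotBl dotZl.
by rewrite (dotC e1); have [_ ->] := V'V _ (e'V i); rewrite mulr0 subr0.
Qed.

Lemma transportD k (e f : 'I_k -> Z) x y :
  transport e f (x + y) = transport e f x + transport e f y.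
Proof.
by rewrite /transport -big_split/=; apply: eq_bigr => i _; rewrite dotDl scalerDl.
Qed.

Lemma transportZ k (e f : 'I_k -> Z) (c : R) x :
  transport e f (c *: x) = c *: transport e f x.
Proof.
by rewrite /transport scaler_sumr; apply: eq_bigr => i _; rewrite dotZl scalerA.
Qed.

Lemma transportB k (e f : 'I_k -> Z) x y :
  transport e f (x - y) = transport e f x - transport e f y.
Proof. by rewrite transportD -scaleN1r transportZ scaleN1r. Qed.

Lemma continuous_transport k (e f : 'I_k -> Z) : continuous (transport e f).
Proof.
apply: continuous_sumf => i; apply: continuous_scalef.
  exact: continuous_dotl.
exact: cst_continuous.
Qed.

Lemma dot_transport k (e f : 'I_k -> Z) x j : orthonormal_family f ->
  dot (transport e f x) (f j) = dot x (e j).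
Proof.
move=> fO; rewrite /transport dot_suml (bigD1 j)//= big1 => [|i ij].
  by rewrite dotZl fO eqxx mulr1 addr0.
by rewrite dotZl fO (negbTE ij) mulr0.
Qed.

Lemma transport_comp k (e f g : 'I_k -> Z) x : orthonormal_family f ->
  transport f g (transport e f x) = transport e g x.
Proof. by move=> fO; apply: eq_bigr => i _; rewrite dot_transport. Qed.

Lemma dnorm_transport k (e f : 'I_k -> Z) x : orthonormal_family f ->
  transport e e x = x -> dnorm dot (transport e f x) = dnorm dot x.
Proof.
move=> fO xe; rewrite /dnorm; congr Num.sqrt.
have dotT (f' : 'I_k -> Z) y :
    dot y (transport e f' x) = \sum_i dot x (e i) * dot y (f' i).
  by rewrite dot_sumr; apply: eq_bigr => i _; rewrite dotZr.
rewrite dotT -[in RHS]xe dotT; apply: eq_bigr => i _.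
by rewrite dot_transport// xe.
Qed.

Lemma transport_in k (e f : 'I_k -> Z) (V : {vspace Z}) x :
  (forall i, f i \in V) -> transport e f x \in V.
Proof. by move=> fV; apply: rpred_sum => i _; exact: memvZ. Qed.

Lemma dimv_orthov (V : {vspace Z}) : (\dim V + \dim (orthov dot V))%N = n.
Proof.
have [e [eV eO ex]] := orthonormal_basis V.
rewrite -dimv_disjoint_sum.
  rewrite (_ : (V + _)%VS = fullv) ?dimvf /dim/= ?mul1n//.
  apply/eqP; rewrite eqEsubv subvf; apply/subvP => x _.
  rewrite -(subrK (transport e e x) x) addrC memv_add ?transport_in//.
  apply/mem_orthovP => y yV; rewrite -[LHS]/(dot _ _) -(ex _ yV) dot_sumr big1// => i _.
  by rewrite dotZr dotBl dot_transport// subrr mulr0.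
apply/eqP; rewrite -subv0; apply/subvP => x; rewrite memv_cap memv0.
move=> /andP[xV /mem_orthovP/(_ _ xV) xx].
by rewrite (dot_eq0 xx).
Qed.

End dot_geometry.

(** * Compact sets, sigma-finiteness and scaling of Lebesgue measure *)

Section compactness.
Context (R : realType) (n : nat).
Local Notation Z := 'rV[R]_n.

Lemma compact_cube k : 0 <= k -> compact (@cube R n k).
Proof.
move=> k0.
have -> : @cube R n k = [set x | `|x| <= k].
  apply/seteqP; split => x /=.
    move=> xk; rewrite /Num.norm/= mx_normrE.
    apply: bigmax_le => // -[i j] _; rewrite ord1; exact: xk.
  move=> xk i; rewrite (le_trans _ xk)// /Num.norm/= mx_normrE.
  exact: (le_trans _ (le_bigmax _ _ (ord0, i))).
apply: bounded_closed_compact.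
  by exists k; split; [exact: num_real|move=> M kM x /=/le_trans; apply; exact: ltW].
rewrite (_ : [set x | _] = (fun x : Z => `|x|) @^-1` [set y | y <= k])//.
apply: closed_comp; last exact: closed_le.
by move=> x _; exact: norm_continuous.
Qed.

Lemma compact_measurable_base d (T : topologicalMeasurableType d)
    (B : nat -> set T) (K : set T) :
  hausdorff_space T -> measurable_base B -> compact K -> measurable K.
Proof.
move=> hT bB cK; rewrite -[K]setCK; apply: measurableC.
apply: (measurable_base_open bB); apply: closed_openC.
exact: compact_closed.
Qed.

Lemma compact_measurable_rV (K : set Z) : compact K -> measurable K.
Proof.
apply: compact_measurable_base (rational_ball_base R n).
exact: norm_hausdorff.
Qed.

Lemma closed_measurable_rV (K : set Z) : closed K -> measurable K.
Proof.
move=> cK; rewrite -[K]setCK; apply: measurableC.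
by apply: (measurable_base_open (rational_ball_base R n)); exact: closed_openC.
Qed.

Lemma compact_finite_pack (m : {measure set Z -> \bar R}) :
  (forall K, compact K -> (m K < +oo)%E) ->
  exists m' : {sigma_finite_measure set Z -> \bar R}, forall A, m' A = m A.
Proof.
move=> mK; apply: sigma_finite_measureP; exists (fun k => @cube R n k%:R).
  by rewrite bigcup_cube.
by move=> k; split; [exact: measurable_cube|exact/mK/compact_cube].
Qed.

End compactness.

Section lebesgue_scaling.
Context (R : realType) (n : nat).
Local Notation Z := 'rV[R]_n.

Lemma measurable_scaleV (c : R) : measurable_fun setT (fun x : Z => c *: x).
Proof.
apply: (continuous_measurable_base_rV (rational_ball_base R n)).
by apply: continuous_scalef; [exact: cst_continuous|exact: continuous_idf].
Qed.

(** The image of [nu] under the dilation is again translation invariant, hence a multiple of [nu];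
    the unit cube, whose preimage is the cube of parameter 1/c, gives the factor. *)
Lemma translation_invariant_scale (nu : {sigma_finite_measure set Z -> \bar R})
    (c : R) (A : set Z) :
  translation_invariant nu ->
  (forall k : R, 0 <= k -> nu (@cube R n k) = ((k *+ 2) ^+ n)%:E) ->
  0 < c -> measurable A ->
  (nu ((fun x => c *: x) @^-1` A) = (c ^- n)%:E * nu A)%E.
Proof.
move=> nuD nuC c0 mA.
have [m mE] := pushforward_measureP nu (measurable_scaleV c).
have mC k : 0 <= k -> m (@cube R n k) = nu (@cube R n (c^-1 * k)).
  move=> k0; rewrite mE; congr (nu _); apply/seteqP.
  split => x /= xk i; have := xk i; rewrite mxE normrM (gtr0_norm c0);
  by rewrite ler_pdivlMl.
have [m' m'E] : exists m' : {sigma_finite_measure set Z -> \bar R},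
    forall A, m' A = m A.
  apply: sigma_finite_measureP; exists (fun k => @cube R n k%:R).
    by rewrite bigcup_cube.
  move=> k; split; [exact: measurable_cube|].
  by rewrite mC// nuC ?ltry// mulr_ge0// invr_ge0 ltW.
have m'D : translation_invariant m'.
  move=> v B mB; rewrite !m'E !mE.
  have mcB : measurable ((fun x : Z => c *: x) @^-1` B).
    by rewrite -[X in measurable X]setTI; exact: measurable_scaleV.
  rewrite -[RHS](nuD (c^-1 *: v) _ mcB).
  congr (nu _); apply/seteqP; split => x /=;
  by rewrite scalerDr scalerA divff ?gt_eqF// scale1r.
have C1 : nu (@cube R n 1) = (2 ^+ n)%:E by rewrite nuC.
have := @translation_invariant_unique _ _ m' nu A (@cube R n 1) (@cube R n 1)
  m'D nuD mA (measurable_cube _) (measurable_cube _).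
rewrite C1 lte_fin exprn_gt0// ltry => /(_ isT isT).
rewrite !m'E mC// mE nuC ?mulr1 ?invr_ge0 ?(ltW c0)//.
have -> : (c^-1 *+ 2) ^+ n = c ^- n * 2 ^+ n.
  by rewrite -[c^-1 *+ 2]mulr_natr exprMn exprVn.
rewrite EFinM -muleA (muleC (2 ^+ n)%:E) => /eqP.
rewrite muleA eq_le !lee_pmul2r ?lte_fin ?exprn_gt0// => /andP[? ?].
by apply/eqP; rewrite eq_le; apply/andP; split.
Qed.

End lebesgue_scaling.

(** The Lipschitz estimate for [phi] with constant c and for its inverse [psi] with constant 1/c.
    Every comparison of Hausdorff measures below is an instance. *)
Lemma hausdorff_similar (R : realType) (V W : zmodType) (nrmV : V -> R)
    (nrmW : W -> R) k (phi : V -> W) (psi : W -> V) (A : set V) (B : set W)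
    (c : R) : 0 < c ->
  (forall x, A x -> B (phi x) /\ psi (phi x) = x) ->
  (forall y, B y -> A (psi y) /\ phi (psi y) = y) ->
  (forall x y, A x -> A y -> nrmW (phi x - phi y) = c * nrmV (x - y)) ->
  hausdorff nrmW k B = ((c ^+ k)%:E * hausdorff nrmV k A)%E.
Proof.
move=> c0 AB BA cA.
have BE : B = phi @` A.
  apply/seteqP; split => [y By|_ [x Ax <-]]; last by have [] := AB _ Ax.
  by have [Ay <-] := BA _ By; exists (psi y).
have AE : A = psi @` B.
  apply/seteqP; split => [x Ax|_ [y By <-]]; last by have [] := BA _ By.
  by have [By <-] := AB _ Ax; exists (phi x).
apply/eqP; rewrite eq_le; apply/andP; split.
  by rewrite BE; apply: hausdorff_image_le => // x y Ax Ay; rewrite cA.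
rewrite -lee_pdivlMl ?exprn_gt0// -exprVn {1}AE.
apply: hausdorff_image_le; first by rewrite invr_gt0.
move=> x y Bx By; have [Ax xE] := BA _ Bx; have [Ay yE] := BA _ By.
by rewrite -{2}xE -{2}yE cA// mulrA mulVf ?mul1r// gt_eqF.
Qed.

(** * Hausdorff measure on E, its direction E0 and E0^perp *)

Section affine_geometry.
Context (R : realType) (n : nat) (dot : {dot 'rV[R]_n for idfun}).
Local Notation Z := 'rV[R]_n.
Variables (a : Z) (E0 : {vspace Z}) (k : nat) (e f : 'I_k -> Z).
Hypothesis eE : forall i, e i \in E0.
Hypothesis eO : orthonormal_family dot e.
Hypothesis ex : forall x, x \in E0 -> transport dot e e x = x.
Hypothesis fP : forall i, f i \in orthov dot E0.
Hypothesis fO : orthonormal_family dot f.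
Hypothesis fx : forall x, x \in orthov dot E0 -> transport dot f f x = x.

Local Notation pr := (transport dot e e).
Local Notation E := (affine_subspace a E0).
Local Notation P := (orthogonal_complement dot E0).
Local Notation hE := (hausdorff_on dot k E).
Local Notation hP := (hausdorff_on dot k P).
Local Notation h0 := (hausdorff_on dot k [set` E0]).

Lemma perpP x : P x <-> x \in orthov dot E0.
Proof.
split => [Px|/mem_orthovP Px v vE]; last exact: Px.
by apply/mem_orthovP => v vE; exact: Px.
Qed.

Lemma pr_in x : pr x \in E0.
Proof. exact: transport_in. Qed.

Lemma in_pr x : x \in E0 <-> pr x = x.
Proof. by split => [/ex//|<-]; exact: pr_in. Qed.

Lemma perp_pr x : P x <-> pr x = 0.
Proof.
split => [Px|x0 v vE].
  by rewrite /transport big1// => i _; rewrite Px// scale0r.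
rewrite -(ex vE) dot_sumr big1// => i _.
by rewrite dotZr -(dot_transport e x i eO) x0 linear0l mulr0.
Qed.

Lemma pr_idem x : pr (pr x) = pr x.
Proof. exact/in_pr/pr_in. Qed.

Lemma perp_sub_pr x : P (x - pr x).
Proof. by apply/perp_pr; rewrite transportB pr_idem subrr. Qed.

Lemma affineP x : E x <-> x - a \in E0.
Proof.
split => [[v /= vE <-]|xa]; first by rewrite addrC addKr.
by exists (x - a) => //; rewrite addrC subrK.
Qed.

Lemma affine_pr x : E x <-> pr (x - a) = x - a.
Proof. by rewrite affineP; exact: in_pr. Qed.

(** [orth_proj] is a chosen point, so uniqueness has to be shown: in y - a = (y - p) + (p - a), [pr]
    kills the first summand and fixes the second. *)
Lemma orth_projE y : orth_proj dot a E0 y = a + pr (y - a).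
Proof.
have ap : [set p | E p /\ P (y - p)] (a + pr (y - a)).
  split; first by apply/affineP; rewrite addrC addKr pr_in.
  by rewrite opprD addrA; exact: perp_sub_pr.
rewrite /orth_proj; have [/affine_pr pE /perp_pr pP] := getI ap.
set p := get _ in pE pP *.
rewrite -[p](subrK a) addrC; congr (_ + _); rewrite -pE.
have -> : y - a = (y - p) + (p - a) by rewrite addrA subrK.
by rewrite [in RHS]transportD pP add0r.
Qed.

Lemma continuous_pr : continuous pr.
Proof. exact: continuous_transport. Qed.

Lemma closed_zero_set (g : Z -> Z) : continuous g -> closed [set x | g x = 0].
Proof.
move=> cg; rewrite (_ : [set x | _] = (fun x => `|g x|) @^-1` [set y | y <= 0]).
  apply: closed_comp; last exact: closed_le.
  move=> x _; apply: (@continuous_comp _ _ _ g (fun y => `|y|)); first exact: cg.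
  exact: norm_continuous.
by apply/seteqP; split => x /=; rewrite normr_le0; [move->|move=> /eqP].
Qed.

Lemma measurable_affine : measurable E.
Proof.
apply: closed_measurable_rV.
rewrite (_ : E = [set x | pr (x - a) - (x - a) = 0]).
  apply: closed_zero_set; apply: continuous_subf.
    have ca : continuous (fun x : Z => x - a).
      by apply: continuous_subf; [exact: continuous_idf|exact: cst_continuous].
    have := continuous_compf ca continuous_pr.
    exact.
  by apply: continuous_subf; [exact: continuous_idf|exact: cst_continuous].
apply/seteqP; split => x /=; first by move/affine_pr => ->; rewrite subrr.
by move=> /eqP; rewrite subr_eq0 => /eqP /affine_pr.
Qed.

Lemma measurable_perp : measurable P.
Proof.
apply: closed_measurable_rV; rewrite (_ : P = [set x | pr x = 0]).
  exact/closed_zero_set/continuous_pr.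
by apply/seteqP; split => x /perp_pr.
Qed.

Lemma measurable_direction : measurable [set` E0].
Proof.
apply: closed_measurable_rV; rewrite (_ : [set` E0] = [set x | pr x - x = 0]).
  apply: closed_zero_set; apply: continuous_subf; first exact: continuous_pr.
  exact: continuous_idf.
apply/seteqP; split => x /=; first by move/in_pr => ->; rewrite subrr.
by move=> /eqP; rewrite subr_eq0 => /eqP /in_pr.
Qed.

Lemma hausdorff_direction B : h0 B = hE ((fun x => x - a) @^-1` B).
Proof.
rewrite /hausdorff_on /restriction -[RHS]mul1e -(expr1n _ k).
apply: (@hausdorff_similar _ _ _ _ _ k (fun x => x - a) (fun x => x + a)) => //.
- by move=> x [Bx /affineP xE]; split => //; rewrite subrK.
- move=> y [By yE]; rewrite addrK; split => //; split; last first.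
    by apply/affineP; rewrite addrK.
  by rewrite /preimage/= addrK.
- by move=> x y _ _; rewrite mul1r opprB addrA subrK.
Qed.

Lemma hausdorff_perp B : hP B = h0 (transport dot e f @^-1` B).
Proof.
rewrite /hausdorff_on /restriction -[RHS]mul1e -(expr1n _ k).
apply: (@hausdorff_similar _ _ _ _ _ k (transport dot e f) (transport dot f e)) => //.
- move=> x [Bx /= xE]; rewrite (transport_comp e e x fO) ex//; split => //; split => //.
  by apply/perpP; exact: transport_in.
- move=> y [By /perpP yP]; rewrite (transport_comp f f y eO) fx//; split => //.
  split; last exact: transport_in.
  by rewrite /preimage/= (transport_comp f f y eO) fx.
- move=> x y [_ /= xE] [_ /= yE]; rewrite mul1r -transportB dnorm_transport//.
  by rewrite ex// rpredB.
Qed.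

Lemma hausdorff_affine_shift v B : v \in E0 ->
  hE ((fun x => x + v) @^-1` B) = hE B.
Proof.
move=> vE; rewrite /hausdorff_on /restriction -[RHS]mul1e -(expr1n _ k).
apply: (@hausdorff_similar _ _ _ _ _ k (fun x => x - v) (fun x => x + v)) => //.
- move=> x [Bx /affineP xE]; rewrite subrK; split => //; split.
    by rewrite /preimage/= subrK.
  by apply/affineP; rewrite addrAC rpredB.
- move=> y [By /affineP yE]; rewrite addrK; split => //; split => //.
  by apply/affineP; rewrite addrAC rpredD.
- by move=> x y _ _; rewrite mul1r opprB addrA subrK.
Qed.

Lemma hausdorff_perp_shift v B : P v ->
  hP ((fun x => x + v) @^-1` B) = hP B.
Proof.
move=> /perpP vP; rewrite /hausdorff_on /restriction -[RHS]mul1e -(expr1n _ k).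
apply: (@hausdorff_similar _ _ _ _ _ k (fun x => x - v) (fun x => x + v)) => //.
- move=> x [Bx /perpP xP]; rewrite subrK; split => //; split.
    by rewrite /preimage/= subrK.
  by apply/perpP; rewrite rpredB.
- move=> y [By /perpP yP]; rewrite addrK; split => //; split => //.
  by apply/perpP; rewrite rpredD.
- by move=> x y _ _; rewrite mul1r opprB addrA subrK.
Qed.

Lemma hausdorff_perp_scale (c : R) B : 0 < c ->
  hP ((fun x => c^-1 *: x) @^-1` B) = ((c ^+ k)%:E * hP B)%E.
Proof.
move=> c0; have cn0 : c != 0 by rewrite gt_eqF.
rewrite /hausdorff_on /restriction.
apply: (@hausdorff_similar _ _ _ _ _ k (fun x => c *: x) (fun x => c^-1 *: x)) => //.
- move=> x [Bx /perpP xP]; rewrite scalerA mulVf// scale1r; split => //; split.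
    by rewrite /preimage/= scalerA mulVf// scale1r.
  by apply/perpP; rewrite memvZ.
- move=> y [By /perpP yP]; rewrite scalerA mulfV// scale1r; split => //.
  by split => //; apply/perpP; rewrite memvZ.
- by move=> x y _ _; rewrite -scalerBr dnormZ gtr0_norm.
Qed.

(** With xi in E fixed, x |-> c (xi - x) maps E onto E0 and multiplies distances by c. This is the
    contribution of zeta to the Jacobian of S_lambda, as [hausdorff_perp_scale] is that of eta. *)
Lemma hausdorff_direction_scale (c : R) xi B : 0 < c -> E xi ->
  h0 ((fun z => xi - c^-1 *: z) @^-1` B) = ((c ^+ k)%:E * hE B)%E.
Proof.
move=> c0 /affineP xiE; have cn0 : c != 0 by rewrite gt_eqF.
rewrite /hausdorff_on /restriction.
apply: (@hausdorff_similar _ _ _ _ _ k (fun x => c *: (xi - x))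
  (fun z => xi - c^-1 *: z)) => //.
- move=> x [Bx /affineP xE]; rewrite scalerA mulVf// scale1r subKr.
  split => //; split; first by rewrite /preimage/= scalerA mulVf// scale1r subKr.
  have -> : xi - x = (xi - a) - (x - a) by rewrite opprB addrA subrK.
  by apply: memvZ; exact: rpredB.
- move=> y [By /= yE]; rewrite subKr scalerA mulfV// scale1r.
  split => //; split => //; apply/affineP.
  by rewrite addrAC rpredB// memvZ.
- move=> x y _ _; rewrite -scalerBr dnormZ gtr0_norm//; congr (_ * _).
  rewrite (_ : xi - x - (xi - y) = - 1 *: (x - y)).
    by rewrite dnormZ normrN1 mul1r.
  by rewrite scaleN1r !opprB addrC addrA subrK.
Qed.

End affine_geometry.

(** * The change of variables S_lambda *)

Section hausdorff_decomposition.
Context (R : realType) (n : nat) (dot : {dot 'rV[R]_n for idfun}).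
Local Notation Z := 'rV[R]_n.
Variables (a : Z) (E0 : {vspace Z}) (k : nat) (e f : 'I_k -> Z).
Hypothesis eE : forall i, e i \in E0.
Hypothesis eO : orthonormal_family dot e.
Hypothesis ex : forall x, x \in E0 -> transport dot e e x = x.
Hypothesis fP : forall i, f i \in orthov dot E0.
Hypothesis fO : orthonormal_family dot f.
Hypothesis fx : forall x, x \in orthov dot E0 -> transport dot f f x = x.

Local Notation pr := (transport dot e e).
Local Notation E := (affine_subspace a E0).
Local Notation P := (orthogonal_complement dot E0).
Local Notation hE := (hausdorff_on dot k E).
Local Notation hP := (hausdorff_on dot k P).
Local Notation h0 := (hausdorff_on dot k [set` E0]).

Definition compact_finite (m : set Z -> \bar R) :=
  forall K, compact K -> (m K < +oo)%E.

Lemma continuous_measurable_rV1 (g : Z -> Z) : continuous g -> measurable_fun setT g.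
Proof. exact: (continuous_measurable_base_rV (rational_ball_base R n)). Qed.

Lemma compact_image (g : Z -> Z) K : continuous g -> compact K -> compact (g @` K).
Proof. by move=> cg cK; apply: continuous_compact => //; exact: continuous_subspaceT. Qed.

Lemma hausdorff_direction_measure (nuE : {measure set Z -> \bar R}) :
  (forall A, measurable A -> hE A = nuE A) -> compact_finite nuE ->
  exists2 nu0 : {sigma_finite_measure set Z -> \bar R},
    forall A, measurable A -> h0 A = nu0 A & compact_finite nu0.
Proof.
move=> hEE finE.
have cB : continuous (fun x : Z => x - a).
  by apply: continuous_subf; [exact: continuous_idf|exact: cst_continuous].
have cD : continuous (fun x : Z => x + a).
  by apply: continuous_addf; [exact: continuous_idf|exact: cst_continuous].
have [m mE] := pushforward_measureP nuE (continuous_measurable_rV1 cB).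
have mfin : compact_finite m.
  move=> K cK; rewrite mE (_ : _ @^-1` _ = (fun x => x + a) @` K).
    by apply: finE; exact: compact_image.
  apply/seteqP; split => [x Kx|_ [x Kx <-]]; last by rewrite /preimage/= addrK.
  by exists (x - a) => //; rewrite subrK.
have [m' m'E] := compact_finite_pack mfin.
exists m' => [A mA|K cK]; rewrite m'E; last exact: mfin.
rewrite mE (hausdorff_direction dot a) hEE// -[X in measurable X]setTI.
exact: continuous_measurable_rV1.
Qed.

(* H^N on E0^perp is the image of H^N on E0 under the isometry U that maps the
   orthonormal basis e to f. *)
Lemma hausdorff_perp_measure (nu0 : {measure set Z -> \bar R}) :
  (forall A, measurable A -> h0 A = nu0 A) -> compact_finite nu0 ->
  exists2 nuP : {sigma_finite_measure set Z -> \bar R},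
    forall A, measurable A -> hP A = nuP A & compact_finite nuP.
Proof.
move=> h0E fin0; pose U := transport dot e f; pose U' := transport dot f e.
have mU : measurable_fun setT U.
  by apply: continuous_measurable_rV1; exact: continuous_transport.
have mpre A : measurable A -> measurable (U @^-1` A).
  by move=> mA; rewrite -[X in measurable X]setTI; exact: mU.
have [m mE] := pushforward_measureP nu0 mU.
have mfin : compact_finite m.
  move=> K cK; have cU'K : compact (U' @` K).
    by apply: compact_image => //; exact: continuous_transport.
  rewrite mE; apply: le_lt_trans (fin0 _ cU'K).
  have mK := compact_measurable_rV cK.
  have mE0 := measurable_direction eE ex.
  have mUK0 : measurable (U @^-1` K `&` [set` E0]).
    by apply: measurableI => //; exact: mpre.
  (* [U] kills E0^perp, so the preimage of a compact set need not be compact. The measure lives on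
     E0, and there [U'] inverts [U], so that the part in E0 lies in the compact image of K under
     [U']. *)
  have -> : nu0 (U @^-1` K) = nu0 (U @^-1` K `&` [set` E0]).
    rewrite -(h0E _ (mpre _ mK)) -(h0E _ mUK0).
    by rewrite /hausdorff_on /restriction -setIA setIid.
  apply: le_measure; rewrite ?inE.
  - exact: mUK0.
  - exact: compact_measurable_rV.
  - move=> x [Kx /= xE]; exists (U x) => //.
    by rewrite /U' (transport_comp e e x fO) ex.
have [m' m'E] := compact_finite_pack mfin.
exists m' => [A mA|K cK]; rewrite m'E; last exact: mfin.
by rewrite mE (hausdorff_perp eE eO ex fP fO fx) h0E//; exact: mpre.
Qed.

Section change_of_variables.
Variables (L nuE nuP nu0 : {sigma_finite_measure set Z -> \bar R}).
Hypothesis LD : translation_invariant L.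
Hypothesis LC : forall r : R, 0 <= r -> L (@cube R n r) = ((r *+ 2) ^+ n)%:E.
Hypothesis hEE : forall [A : set Z], measurable A -> hE A = nuE A.
Hypothesis hPE : forall [A : set Z], measurable A -> hP A = nuP A.
Hypothesis h0E : forall [A : set Z], measurable A -> h0 A = nu0 A.
Hypothesis finE : compact_finite nuE.
Hypothesis finP : compact_finite nuP.
Hypothesis nuE_neq0 : nuE setT != 0%E.

Local Notation nuEP := (nuE \x nuP)%E.

Let mE : measurable E := measurable_affine a eE ex.
Let mP : measurable P := measurable_perp eE eO ex.

Lemma affine_full : nuE (~` E) = 0%E.
Proof.
rewrite -hEE; last exact: measurableC.
by rewrite /hausdorff_on /restriction setICl -(set0I E) -[LHS]/(hE set0) hEE// measure0.
Qed.

Lemma perp_full : nuP (~` P) = 0%E.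
Proof.
rewrite -hPE; last exact: measurableC.
by rewrite /hausdorff_on /restriction setICl -(set0I P) -[LHS]/(hP set0) hPE// measure0.
Qed.

Lemma direction_full : nu0 (~` [set` E0]) = 0%E.
Proof.
have m0 := measurable_direction eE ex.
rewrite -h0E; last exact: measurableC.
by rewrite /hausdorff_on /restriction setICl -(set0I [set` E0])
  -[LHS]/(h0 set0) h0E// measure0.
Qed.

(** [A |-> nuEP (sum_set A)] is the image of H^N|E x H^N|E0^perp under addition, the measure to be
    compared with Lebesgue measure. *)
Definition sum_set (A : set Z) : set (Z * Z) := [set q | A (q.1 + q.2)].

Let cD : continuous (fun q : Z * Z => q.1 + q.2).
Proof. by apply: continuous_addf => x; [exact: cvg_fst|exact: cvg_snd]. Qed.

Lemma measurable_sum_set A : measurable A -> measurable (sum_set A).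
Proof.
move=> mA; rewrite -[X in measurable X]setTI.
exact: (continuous_measurable_rV2 cD).
Qed.

(** Split [v] into its components in E0 and E0^perp: the first shift preserves [nuE], the second
    [nuP]. *)
Lemma sum_measure_shift (v : Z) (A : set Z) : measurable A ->
  nuEP (sum_set ((fun x => x + v) @^-1` A)) = nuEP (sum_set A).
Proof.
move=> mA; pose v1 := pr v; pose v2 := v - pr v.
have mt : measurable_fun setT (fun q : Z * Z => (q.1 + v1, q.2 + v2)).
  apply/measurable_fun_pairP; split.
    apply: continuous_measurable_rV2; apply: continuous_addf.
      by move=> x; exact: cvg_fst.
    exact: cst_continuous.
  apply: continuous_measurable_rV2; apply: continuous_addf.
    by move=> x; exact: cvg_snd.
  exact: cst_continuous.
have [m mE'] := pushforward_measureP nuEP mt.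
rewrite (_ : sum_set _ = (fun q : Z * Z => (q.1 + v1, q.2 + v2)) @^-1` sum_set A).
  rewrite -mE'; apply/esym/product_measure_unique; last exact: measurable_sum_set.
  move=> B C mB mC; rewrite mE'.
  have mBv : measurable ((fun x : Z => x + v1) @^-1` B).
    by rewrite -[X in measurable X]setTI; exact: measurable_addrV.
  have mCv : measurable ((fun x : Z => x + v2) @^-1` C).
    by rewrite -[X in measurable X]setTI; exact: measurable_addrV.
  transitivity (nuEP (((fun x => x + v1) @^-1` B) `*` ((fun x => x + v2) @^-1` C))) => //.
  rewrite product_measure1E//; congr (_ * _)%E.
    apply: etrans (hEE mB); apply: etrans (esym (hEE mBv)) _.
    exact/hausdorff_affine_shift/pr_in.
  apply: etrans (hPE mC); apply: etrans (esym (hPE mCv)) _.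
  exact/hausdorff_perp_shift/perp_sub_pr.
have vE : v1 + v2 = v by rewrite addrC subrK.
by apply/seteqP; split => -[x y] /=; rewrite /sum_set/= addrACA vE.
Qed.

(** A sum of a point of E and a point of E0^perp determines both: [p] and [q] recover them
    continuously. Up to null sets, [sum_set] of the cube thus lies in a product of two compact
    sets. *)
Lemma sum_measure_cube (r : R) : 0 <= r -> (nuEP (sum_set (@cube R n r)) < +oo)%E.
Proof.
move=> r0.
pose p y : Z := a + pr (y - a); pose q y := y - p y.
have cp : continuous p.
  apply: continuous_addf; first exact: cst_continuous.
  have ca : continuous (fun x : Z => x - a).
    by apply: continuous_subf; [exact: continuous_idf|exact: cst_continuous].
  have := continuous_compf ca (continuous_pr (dot := dot) (e := e)).
  exact.
have cq : continuous q by apply: continuous_subf => //; exact: continuous_idf.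
have c1 : compact (@cube R n r) by exact: compact_cube.
have cK1 := compact_image cp c1; have cK2 := compact_image cq c1.
have mK1 := compact_measurable_rV cK1; have mK2 := compact_measurable_rV cK2.
have mA1 : measurable (~` E `*` [set: Z]).
  by apply: measurableX => //; exact: measurableC.
have mA2 : measurable ([set: Z] `*` ~` P).
  by apply: measurableX => //; exact: measurableC.
have mA3 : measurable ((p @` cube r) `*` (q @` cube r)) by exact: measurableX.
apply: (@le_lt_trans _ _ (nuEP
    ((p @` cube r) `*` (q @` cube r) `|` (~` E `*` setT `|` setT `*` ~` P)))).
  apply: le_measure; rewrite ?inE.
  - by apply: measurable_sum_set; exact: measurable_cube.
  - by apply: measurableU => //; exact: measurableU.
  move=> [x y] /= xy.
  have [xE|] := pselect (E x); last by move=> ?; right; left.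
  have [yP|] := pselect (P y); last by move=> ?; right; right.
  have pE : p (x + y) = x.
    rewrite /p addrAC transportD; move/(affine_pr a eE ex): xE => ->.
    by move/(perp_pr eE eO ex) : yP => ->; rewrite addr0 addrC subrK.
  by left; split => /=; exists (x + y) => //; rewrite /q pE addrC addKr.
apply: (le_lt_trans (measureU2 _ _ _)) => //; first exact: measurableU.
apply: lte_add_pinfty.
  rewrite -[X in (X < _)%E]/(nuEP ((p @` cube r) `*` (q @` cube r))).
  rewrite product_measure1E// lte_mul_pinfty ?finP//.
  by rewrite ge0_fin_numE// finE.
apply: (le_lt_trans (measureU2 _ _ _)) => //.
rewrite -[X in (X + _ < _)%E]/(nuEP (~` E `*` setT)).
rewrite -[X in (_ + X < _)%E]/(nuEP (setT `*` ~` P)).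
rewrite (product_null1 _ (measurableC mE) affine_full).
by rewrite (product_null2 _ (measurableC mP) perp_full) adde0.
Qed.

Lemma sum_measure_lebesgue : exists2 c : R, 0 < c &
  forall A, measurable A -> nuEP (sum_set A) = (c%:E * L A)%E.
Proof.
have [m mE'] := pushforward_measureP nuEP (continuous_measurable_rV2 cD).
have mS A : m A = nuEP (sum_set A) by rewrite mE'.
have [m' m'E] : exists m' : {sigma_finite_measure set Z -> \bar R},
    forall A, m' A = m A.
  apply: sigma_finite_measureP; exists (fun k => @cube R n k%:R).
    by rewrite bigcup_cube.
  by move=> j; split; [exact: measurable_cube|rewrite mS; exact: sum_measure_cube].
have m'D : translation_invariant m'.
  by move=> v A mA; rewrite !m'E !mS; exact: sum_measure_shift.
have C1 : L (@cube R n 1) = (2 ^+ n)%:E by rewrite LC.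
have uniq A : measurable A -> (m' A * (2 ^+ n)%:E = m' (@cube R n 1) * L A)%E.
  move=> mA; have := @translation_invariant_unique _ _ m' L A (@cube R n 1)
    (@cube R n 1) m'D LD mA (measurable_cube _) (measurable_cube _).
  by rewrite C1 lte_fin exprn_gt0// ltry; exact.
have fin1 : m' (@cube R n 1) \is a fin_num.
  by rewrite ge0_fin_numE// m'E mS; exact: sum_measure_cube.
(* A null unit cube would, by proportionality, make the whole sum measure vanish. Its total mass is
   the product of those of [nuE] and [nuP], which are equal because E and E0^perp are isometric, and
   [nuE] is not zero. *)
have pos1 : (0 < m' (@cube R n 1))%E.
  rewrite lt0e measure_ge0 andbT; apply/eqP => m0.
  have := uniq setT measurableT; rewrite m0 mul0e m'E mS.
  rewrite (_ : sum_set setT = setT `*` setT); last by apply/seteqP; split.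
  rewrite product_measure1E// => /eqP.
  have PE : nuP setT = nuE setT.
    apply: etrans (esym (hPE measurableT)) _.
    apply: etrans (hEE measurableT).
    by rewrite (hausdorff_perp eE eO ex fP fO fx) preimage_setT
      (hausdorff_direction dot a) preimage_setT.
  rewrite !mule_eq0 eqe expf_eq0 pnatr_eq0 andbF orbF.
  rewrite -[X in _ || (X == _)]/(nuP setT) PE orbb.
  exact/negP.
exists (fine (m' (@cube R n 1)) / 2 ^+ n).
  by rewrite divr_gt0 ?exprn_gt0// fine_gt0// pos1 -ge0_fin_numE.
move=> A mA; rewrite -mS -m'E mulrC EFinM -muleA fineK//.
rewrite -uniq// muleC -muleA -EFinM mulfV ?mule1//.
Qed.

Lemma measurable_S_map (l : R) : measurable_fun setT (@S_map R n l).
Proof.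
have [B1 bB1] := measurable_base_prod (rational_ball_base R n) (rational_ball_base R n).
have [B2 bB2] := measurable_base_prod bB1 (rational_ball_base R n).
have c1 : continuous (fun p : Z * Z * Z => p.1.1).
  apply: (@continuous_compf _ _ _ (fun p : Z * Z * Z => p.1) (fun q => q.1)) => x;
  exact: cvg_fst.
have c2 : continuous (fun p : Z * Z * Z => p.1.2).
  apply: (@continuous_compf _ _ _ (fun p : Z * Z * Z => p.1) (fun q => q.2)) => x.
    exact: cvg_fst.
  exact: cvg_snd.
have c3 : continuous (fun p : Z * Z * Z => p.2) by move=> x; exact: cvg_snd.
rewrite (_ : @S_map R n l =
    fun p => (p.1.1 + l^-1 *: p.1.2, p.1.1 - l^-1 *: p.2)); last first.
  by apply/funext => -[[x y] z].
apply/measurable_fun_pairP; split; apply: (continuous_measurable_base_rV bB2).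
  apply: continuous_addf => //; apply: continuous_scalef => //.
  exact: cst_continuous.
apply: continuous_subf => //; apply: continuous_scalef => //.
exact: cst_continuous.
Qed.

(** Integrating zeta first gives l^k nuE(B) for every xi in E, whatever eta is; integrating eta then
    gives the second factor l^k. *)
Lemma S_map_rectangle (l : R) A B : 0 < l -> measurable A -> measurable B ->
  ((nuEP \x nu0) (@S_map R n l @^-1` (A `*` B)) =
   (l ^+ (k + k))%:E * (nuEP (sum_set A) * nuE B))%E.
Proof.
move=> l0 mA mB; set S := _ @^-1` _.
have mS : measurable S.
  by rewrite -[X in measurable X]setTI; apply: measurable_S_map => //; exact: measurableX.
pose D : set (Z * Z) := [set q | A (q.1 + l^-1 *: q.2)].
have mD : measurable D.
  rewrite -[X in measurable X]setTI; apply: continuous_measurable_rV2 => //.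
  apply: continuous_addf => [x|]; first exact: cvg_fst.
  apply: continuous_scalef => [|x]; first exact: cst_continuous.
  exact: cvg_snd.
have lk0 : 0 <= l ^+ k by rewrite exprn_ge0// ltW.
have nuD : nuEP D = ((l ^+ k)%:E * nuEP (sum_set A))%E.
  rewrite /product_measure1 -ge0_integralZl//; last first.
    by apply: measurable_fun_xsection; exact: measurable_sum_set.
  apply: eq_integral => x _ /=.
  have mAx : measurable (xsection (sum_set A) x).
    by apply: measurable_xsection; exact: measurable_sum_set.
  have mDx : measurable (xsection D x) by exact: measurable_xsection.
  apply: etrans (esym (hPE mDx)) _; rewrite -[X in (_ * X)%E](hPE mAx).
  rewrite -hausdorff_perp_scale//; congr (hP _).
transitivity (\int[nuEP]_q ((\1_D q)%:E * ((l ^+ k)%:E * nuE B)))%E; last first.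
  rewrite ge0_integralZr//; last 2 first.
  - exact/measurable_EFinP.
  - by rewrite mule_ge0// lee_fin.
  rewrite integral_indic// setIT; rewrite -[X in (X * _)%E]/(nuEP D) nuD.
  by rewrite exprD EFinM muleACA !muleA.
apply: ge0_ae_eq_integral => //.
- exact: measurable_fun_xsection.
- apply: emeasurable_funM => //; exact/measurable_EFinP.
- by move=> q _; rewrite !mule_ge0// lee_fin.
exists (~` E `*` setT); split.
- by apply: measurableX => //; exact: measurableC.
- exact: (product_null1 _ (measurableC mE) affine_full).
move=> [x y] /=; apply: contra_notP => h _.
have xE : E x by apply: contrapT => xE; exact: h.
have mSx : measurable (xsection S (x, y)) by exact: measurable_xsection.
have [xyD|xyD] := pselect (D (x, y)).
  rewrite indicE mem_set// mul1e; apply: etrans (esym (h0E mSx)) _.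
  rewrite -[X in (_ * X)%E](hEE mB) -(hausdorff_direction_scale _ _ _ l0 xE).
  congr (h0 _); apply/seteqP; split => z; rewrite /xsection/= !inE; first by case.
  by move=> zB; split.
rewrite indicE memNset// mul0e (_ : xsection _ _ = set0) ?measure0//.
by apply/seteqP; split => z //; rewrite /xsection/= inE => -[].
Qed.

(** The rescaled image of the triple product under [S_map l] agrees with [L \x nuE] on rectangles,
    hence on all Borel sets. The constant is chosen before [l], as the limit in h requires. *)
Lemma lebesgue_S_map : exists2 c : R, 0 < c & forall l, 0 < l ->
  forall F : Z * Z -> \bar R, measurable_fun setT F ->
    (forall q, 0 <= F q)%E ->
  (\int[L \x nuE]_q F q =
   (c * l ^- (k + k))%:E * \int[nuEP \x nu0]_p F (S_map l p))%E.
Proof.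
have [c c0 cE] := sum_measure_lebesgue; exists c^-1; first by rewrite invr_gt0.
move=> l l0 F mF F0.
have r0 : 0 <= c^-1 * l ^- (k + k).
  by rewrite mulr_ge0 ?invr_ge0 ?exprn_ge0// ltW.
have [m mmE] := pushforward_measureP (nuEP \x nu0)%E (measurable_S_map l).
transitivity (\int[mscale (NngNum r0) m]_q F q)%E.
  apply: eq_set_function_integral => X mX; apply: product_measure_unique => // A B mA mB.
  transitivity ((c^-1 * l ^- (k + k))%:E * m (A `*` B))%E => //.
  rewrite (etrans (mmE _) (S_map_rectangle l0 mA mB)) cE// -[X in (_ * (_ * X))%E]muleA.
  rewrite !muleA -!EFinM (_ : _ * c = 1) ?mul1e//.
  by rewrite divfK ?mulVf ?expf_neq0 ?gt_eqF.
rewrite ge0_integral_mscale//=; congr (_ * _)%E.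
transitivity (\int[pushforward (nuEP \x nu0)%E (@S_map R n l)]_q F q)%E.
  by apply: eq_set_function_integral => X mX; rewrite mmE.
by rewrite ge0_integral_pushforward//; exact: measurable_S_map.
Qed.

End change_of_variables.
End hausdorff_decomposition.

(** * Product, Radon and thermalized measures *)

Lemma hausdorff_ge0 (R : realType) (V : zmodType) (nrm : V -> R) k (A : set V) :
  (0 <= hausdorff nrm k A)%E.
Proof.
apply: (@le_trans _ _ (hausdorff_content nrm k 1 A)).
  apply: le_ereal_inf_tmp => _ [U _ <-]; apply: nneseries_ge0 => i _ _.
  exact: hausdorff_size_ge0.
by apply: ereal_sup_ubound; exists 1 => //=; exact: ltr01.
Qed.

(* If mu = nu x h then h(B) = mu(A x B) / nu(A): the set function h inherits
   countable additivity from mu. *)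
Lemma right_factor_measure d1 d2 (T1 : measurableType d1)
    (T2 : measurableType d2) (R : realType)
    (mu : {measure set (T1 * T2) -> \bar R}) (nu : {measure set T1 -> \bar R})
    (h : set T2 -> \bar R) (A : set T1) :
  (forall B, 0 <= h B)%E ->
  (forall X, measurable X -> mu X = (nu \x h)%E X) ->
  measurable A -> (0 < nu A)%E -> (nu A < +oo)%E ->
  exists m : {measure set T2 -> \bar R}, forall B, measurable B ->
    h B = m B /\ (mu (A `*` B) = nu A * m B)%E.
Proof.
move=> h0 muE mA A0 Aoo.
have muAB B : measurable B -> mu (A `*` B) = (nu A * h B)%E.
  move=> mB; rewrite muE; last exact: measurableX.
  rewrite /product_measure1 /=.
  rewrite (eq_integral (fun x => (\1_A x)%:E * h B)%E); last first.
    move=> x _; rewrite indicE; have [xA|xA] /= := boolP (x \in A).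
      by rewrite in_xsectionX// mul1e.
    rewrite mul0e notin_xsectionX//; apply/eqP.
    (* [h] is an arbitrary set function, so that h(set0) = 0 has to be deduced: mu(set0) = 0 is
       nu(setT) h(set0), and nu(setT) is positive. *)
    have := muE _ (measurable0 : measurable (set0 : set (T1 * T2))).
    rewrite measure0 /product_measure1 /= => /esym.
    rewrite (eq_integral (cst (h set0))); last by move=> ? _; rewrite xsection0.
    rewrite integral_cst// => /eqP; rewrite mule_eq0 => /orP[//|/eqP nuT0].
    have : (nu A <= nu setT)%E by apply: le_measure; rewrite ?inE.
    by rewrite nuT0 leNgt A0.
  rewrite ge0_integralZr//; last exact/measurable_EFinP.
  by rewrite integral_indic// setIT.
have mAT : measurable (A `*` [set: T2]) by exact: measurableX.
have [m0 m0E] := pushforward_measureP (mrestr mu mAT) measurable_snd.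
have Afin : nu A \is a fin_num by rewrite ge0_fin_numE.
have r0 : 0 <= (fine (nu A))^-1 by rewrite invr_ge0 fine_ge0.
exists (mscale (NngNum r0) m0) => B mB.
have m0B : m0 B = (nu A * h B)%E.
  rewrite m0E -muAB// /mrestr; congr (mu _).
  by apply/seteqP; split => -[x y] /=; [move=> [? []]|move=> []].
have mE : mscale (NngNum r0) m0 B = h B.
  transitivity ((fine (nu A))^-1%:E * m0 B)%E => //.
  rewrite m0B muleA -{2}(fineK Afin) -EFinM mulVf ?mul1e//.
  by rewrite gt_eqF// fine_gt0// A0 -ge0_fin_numE.
split; first exact: esym mE.
by apply: etrans (muAB _ mB) _; congr (_ * _)%E; exact: esym mE.
Qed.

(** By Tonelli. It presents mu_D x H^N|E as a density over [L \x nuE], the measure to which the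
    change of variables applies. *)
Lemma density_product d1 d2 (T1 : measurableType d1) (T2 : measurableType d2)
    (R : realType) (m1 : {sigma_finite_measure set T1 -> \bar R})
    (m2 : {sigma_finite_measure set T2 -> \bar R}) (v : T1 -> R)
    (mv : measurable_fun setT v) (v0 : forall x, 0 <= v x) X :
  measurable X ->
  (mdensity m1 mv v0 \x m2)%E X = density (m1 \x m2)%E (v \o fst) X.
Proof.
move=> mX; have mv1 : measurable_fun setT (v \o (@fst T1 T2)).
  exact: measurableT_comp.
transitivity (\int[m1]_x (m2 (xsection X x) * (v x)%:E))%E.
  by apply: integral_mdensity => //; exact: measurable_fun_xsection.
rewrite /density [RHS]integral_mkcond.
transitivity (\int[m1 \x m2]_q ((\1_X q)%:E * (v q.1)%:E))%E; last first.
  by apply: eq_integral => q _; rewrite epatch_indic muleC.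
rewrite fubini_tonelli1//=; last 2 first.
- apply: emeasurable_funM; first exact/measurable_EFinP.
  exact/measurable_EFinP.
- by move=> q; rewrite mule_ge0 ?lee_fin.
apply: eq_integral => x _; rewrite /fubini_F/=.
rewrite ge0_integralZr//; last 2 first.
- apply/measurable_EFinP.
  rewrite (_ : (fun _ => _) = \1_(xsection X x)).
    by apply: measurable_indic; exact: measurable_xsection.
  by apply/funext => y; rewrite !indicE mem_xsection.
- by rewrite lee_fin.
congr (_ * _)%E; have := indic_fubini_tonelli_FE m2 mX.
by move/(congr1 (fun f => f x)) => /= <-.
Qed.

(** Dominated convergence for u - w, where neither sequence is assumed to converge. Bounding the sum
    u + w makes both integrals finite, so that their difference is the integral of u - w; the shift
    by [h0] leaves only indices where the bound holds. *)
Lemma dominated_difference d (T : measurableType d) (R : realType)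
    (m : {measure set T -> \bar R}) (u w : nat -> T -> R) (G : T -> \bar R)
    (h0 : nat) :
  (forall h, measurable_fun setT (u h)) ->
  (forall h, measurable_fun setT (w h)) ->
  (forall h x, 0 <= u h x) -> (forall h x, 0 <= w h x) ->
  m.-integrable setT G ->
  (forall h, (h0 <= h)%N -> {ae m, forall x, ((u h x + w h x)%:E <= G x)%E}) ->
  {ae m, forall x, (u h x - w h x) @[h --> \oo] --> 0} ->
  [/\ forall h, (h0 <= h)%N -> (\int[m]_x (u h x)%:E < +oo)%E,
      forall h, (h0 <= h)%N -> (\int[m]_x (w h x)%:E < +oo)%E &
      (\int[m]_x (u h x)%:E - \int[m]_x (w h x)%:E)%E @[h --> \oo] --> 0%E].
Proof.
move=> mu mw u0 w0 iG uwG uw0.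
have mE (x : nat -> T -> R) h : measurable_fun setT (x h) ->
    measurable_fun setT (EFin \o x h) by move=> ?; exact/measurable_EFinP.
have Goo : (\int[m]_x `|G x| < +oo)%E by have /integrableP[] := iG.
have mG : measurable_fun setT (fun x => `|G x|)%E.
  by apply: measurableT_comp => //; exact: measurable_int iG.
have uoo h : (h0 <= h)%N -> (\int[m]_x (u h x)%:E < +oo)%E.
  move=> hh; apply: le_lt_trans Goo; apply: ae_ge0_le_integral => //.
  - by move=> x _; rewrite lee_fin.
  - exact: mE.
  - apply: filterS (uwG h hh) => x uwx _; apply: le_trans (lee_abs _).
    by apply: le_trans uwx; rewrite lee_fin lerDl.
have woo h : (h0 <= h)%N -> (\int[m]_x (w h x)%:E < +oo)%E.
  move=> hh; apply: le_lt_trans Goo; apply: ae_ge0_le_integral => //.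
  - by move=> x _; rewrite lee_fin.
  - exact: mE.
  - apply: filterS (uwG h hh) => x uwx _; apply: le_trans (lee_abs _).
    by apply: le_trans uwx; rewrite lee_fin lerDr.
split => //; pose D h x := (u (h + h0)%N x - w (h + h0)%N x)%:E.
have mD h : measurable_fun setT (D h).
  by apply/measurable_EFinP; exact: measurable_funB.
have D0 : {ae m, forall x, setT x -> D ^~ x @ \oo --> (cst 0%E : T -> \bar R) x}.
  apply: filterS uw0 => x uw0x _; apply: cvg_EFin; first exact: nearW.
  by move: uw0x; rewrite -(cvg_shiftn h0); exact.
have DG : {ae m, forall x h, setT x -> (`|D h x| <= `|G x|)%E}.
  have : {ae m, forall x, forall h,
      ((u (h + h0)%N x + w (h + h0)%N x)%:E <= G x)%E}.
    by apply: ae_foralln => h; apply: uwG; rewrite leq_addl.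
  apply: filterS => x uwx h _; apply: le_trans (lee_abs _).
  apply: le_trans (uwx h); rewrite /D abse_EFin lee_fin.
  by rewrite (le_trans (ler_normB _ _))// !ger0_norm.
have iG' : m.-integrable setT (fun x => `|G x|)%E by exact: integrable_abse.
have [_ _] := dominated_convergence measurableT mD (measurable_cst _) D0 iG' DG.
rewrite integral0 => DC; rewrite -(cvg_shiftn h0).
apply: cvg_trans DC; apply: near_eq_cvg; near=> h.
have hh : (h0 <= h + h0)%N by rewrite leq_addl.
have iu : m.-integrable setT (EFin \o u (h + h0)%N).
  apply/integrableP; split; first exact: mE.
  by under eq_integral => x _ do rewrite /= ger0_norm//; exact: uoo.
have iw : m.-integrable setT (EFin \o w (h + h0)%N).
  apply/integrableP; split; first exact: mE.
  by under eq_integral => x _ do rewrite /= ger0_norm//; exact: woo.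
exact: (integralB_EFin measurableT iu iw).
Unshelve. all: by end_near.
Qed.

(** * Bounded densities of Radon measures *)

Section radon_density.
Context (R : realType) (n : nat).
Local Notation Z := 'rV[R]_n.
Local Open Scope ereal_scope.

Lemma compact_measurable_rV2 (K : set (Z * Z)) : compact K -> measurable K.
Proof.
have [B bB] := measurable_base_prod (rational_ball_base R n) (rational_ball_base R n).
by apply: compact_measurable_base bB; exact: norm_hausdorff.
Qed.

Variables (mu : {measure set (Z * Z) -> \bar R}) (w : Z * Z -> R) (M : R).
Hypothesis mu_radon : radon mu.
Hypothesis mw : measurable_fun setT w.
Hypothesis w0 : forall x, (0 <= w x)%R.
Hypothesis wM : forall x, (w x <= M)%R.

Let nu : {measure set (Z * Z) -> \bar R} := mdensity mu mw w0.

Let M0 : (0 <= M)%R.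
Proof. exact: le_trans (w0 (0, 0)%R) (wM _). Qed.

Let nu_le A : measurable A -> nu A <= M%:E * mu A.
Proof.
move=> mA; rewrite -integral_cst//; apply: ge0_le_integral => //.
- by move=> x _; rewrite lee_fin.
- by apply/measurable_EFinP; exact: measurable_funTS.
- by move=> x _; rewrite lee_fin.
Qed.

(** Inner regularity passes from [mu] to [nu] because [nu] is at most M times [mu]: a compact K that
    misses little of A for [mu] misses little for [nu]. *)
Let inner_approx A : measurable A -> mu A < +oo ->
  nu A <= ereal_sup [set nu K | K in [set K | compact K /\ K `<=` A]].
Proof.
move=> mA Aoo; apply/lee_addgt0Pr => eps eps0.
have [_ _ /(_ _ mA) AE] := mu_radon.
have Afin : mu A \is a fin_num by rewrite ge0_fin_numE.
(* Dividing by M + 1 rather than M covers M = 0. *)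
pose del := (eps / (M + 1))%R.
have M1 : (0 < M + 1)%R by rewrite ltr_wpDl.
have del0 : (0 < del)%R by rewrite divr_gt0.
have [_ [K [cK KA] <-] KAe] : exists2 y,
    [set mu K | K in [set K | compact K /\ K `<=` A]] y & mu A - del%:E < y.
  have := @ub_ereal_sup_adherent _
    [set mu K | K in [set K | compact K /\ K `<=` A]] del del0.
  by rewrite -AE => /(_ Afin) [y yA yd]; exists y.
have mK := compact_measurable_rV2 cK.
have mAK : measurable (A `\` K) by exact: measurableD.
have AKe : mu (A `\` K) <= del%:E.
  rewrite measureD// (setIidr KA) leeBlDr//; last first.
    by rewrite ge0_fin_numE// (le_lt_trans _ Aoo)// le_measure ?inE.
  by rewrite addeC -leeBlDr// ltW.
have -> : nu A = nu K + nu (A `\` K).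
  rewrite -measureU//; last by rewrite setDE setICA setICr setI0.
  by rewrite setDUK.
apply: leeD; first by apply: ereal_sup_ubound; exists K.
apply: (le_trans (nu_le mAK)); apply: (@le_trans _ _ (M%:E * del%:E)).
  by rewrite lee_wpmul2l// lee_fin.
rewrite -EFinM lee_fin /del mulrCA ler_piMr ?(ltW eps0)//.
by rewrite ler_pdivrMr// mul1r lerDl.
Qed.

Lemma radon_density : density mu w setT < +oo -> bounded_radon (density mu w).
Proof.
move=> fin; split => //; split.
- by exists nu.
- move=> K /compact_measurable_rV2 mK; apply: le_lt_trans fin.
  by apply: (@le_measure _ _ _ nu); rewrite ?inE.
- move=> A mA; apply/eqP; rewrite eq_le; apply/andP; split; last first.
    apply: ub_ereal_sup => _ [K [cK KA] <-].
    apply: (@le_measure _ _ _ nu); rewrite ?inE//.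
    exact: compact_measurable_rV2.
  (* [A] may have infinite [mu]-mass. Its parts in compact boxes have finite mass, and their
     [nu]-masses increase to that of [A]. *)
  pose C j := @cube R n j%:R `*` @cube R n j%:R.
  have cC j : compact (C j) by apply: compact_setX; exact: compact_cube.
  have mC j : measurable (C j) by exact: compact_measurable_rV2.
  have ndC : nondecreasing_seq (fun j => A `&` C j).
    move=> i j ij; apply/subsetPset; apply: setIS => -[x y] /= [xi yi].
    by split => l; [apply: (le_trans (xi l))|apply: (le_trans (yi l))];
      rewrite ler_nat.
  have UC : \bigcup_j (A `&` C j) = A.
    rewrite -setI_bigcupr setIidl// => -[x y] _.
    have : (\bigcup_(k : nat) @cube R n k%:R) x by rewrite bigcup_cube.
    have : (\bigcup_(k : nat) @cube R n k%:R) y by rewrite bigcup_cube.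
    move=> [j _ yj] [i _ xi]; exists (maxn i j) => //; split => l /=.
      by rewrite (le_trans (xi l))// ler_nat leq_maxl.
    by rewrite (le_trans (yj l))// ler_nat leq_maxr.
  have mAC j : measurable (A `&` C j) by exact: measurableI.
  have cvgA : nu (A `&` C j) @[j --> \oo] --> nu A.
    rewrite -[in X in _ --> X]UC; apply: nondecreasing_cvg_mu => //.
    by rewrite UC.
  rewrite -[leLHS]/(nu A) -(cvg_lim _ cvgA)//.
  apply: lime_le; first by apply/cvg_ex; exists (nu A).
  apply: nearW => j; apply: (le_trans (inner_approx (mAC j) _)).
    have [_ Kfin _] := mu_radon; apply: le_lt_trans (Kfin _ (cC j)).
    by apply: le_measure; rewrite ?inE//.
  apply: ereal_sup_le => _ [K [cK KA] <-]; exists K => //; split => //.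
  by move=> x /KA [].
Qed.

End radon_density.

(** * The Gaussian weight and its normalisation *)

Section thermal_weight.
Context (R : realType) (n : nat) (dot : {dot 'rV[R]_n for idfun}).
Local Notation Z := 'rV[R]_n.

Lemma gauss_mass_ge0 b : 0 <= gauss_mass dot b.
Proof.
have [L [LE _ _]] := lebesgue_row R n.
rewrite /gauss_mass (eq_set_function_integral _ _ LE).
by apply/fine_ge0/integral_ge0 => x _; rewrite lee_fin expR_ge0.
Qed.

Lemma thermal_weight_ge0 b q : 0 <= thermal_weight dot b q.
Proof. by rewrite mulr_ge0 ?invr_ge0 ?gauss_mass_ge0 ?expR_ge0. Qed.

Lemma thermal_weight_le b q : 0 <= b -> thermal_weight dot b q <= (gauss_mass dot b)^-1.
Proof.
move=> b0; rewrite /thermal_weight ler_piMr ?invr_ge0 ?gauss_mass_ge0//.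
by rewrite -expR0 ler_expR mulNr oppr_le0 mulr_ge0 ?sqr_ge0.
Qed.

Lemma continuous_expR_sqr_dnorm (T : topologicalType) (b : R) (g : T -> Z) :
  continuous g -> continuous (fun x => expR (- b * dnorm dot (g x) ^+ 2)).
Proof.
move=> cg; apply: (@continuous_compf _ _ _ (fun x => - b * dnorm dot (g x) ^+ 2) expR).
  have cd : continuous (fun x => dnorm dot (g x)).
    by apply: continuous_compf => //; exact: continuous_dnorm.
  move=> x; apply: cvgM; first exact: cvg_cst.
  by apply: cvgM; exact: cd.
exact: continuous_expR.
Qed.

Lemma measurable_thermal_weight b : measurable_fun setT (thermal_weight dot b).
Proof.
apply: measurable_funM => //.
have [B bB] := measurable_base_prod (rational_ball_base R n) (rational_ball_base R n).
apply: (continuous_measurable_base bB); apply: continuous_expR_sqr_dnorm.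
by apply: continuous_subf => x; [exact: cvg_fst|exact: cvg_snd].
Qed.

(** The substitution x |-> l x in the Gaussian integral. *)
Lemma gauss_mass_scale (L : {sigma_finite_measure set Z -> \bar R}) (b l : R) :
  (forall A, measurable A -> lebesgue A = L A) -> translation_invariant L ->
  (forall r : R, 0 <= r -> L (@cube R n r) = ((r *+ 2) ^+ n)%:E) ->
  0 < l -> gauss_mass dot (b * l ^+ 2) = l ^- n * gauss_mass dot b.
Proof.
move=> lebE LD LC l0.
pose F x := (expR (- b * dnorm dot x ^+ 2))%:E.
have mF : measurable_fun setT F.
  apply/measurable_EFinP; apply: (continuous_measurable_base (rational_ball_base R n)).
  exact/continuous_expR_sqr_dnorm/continuous_idf.
have F0 x : (0 <= F x)%E by rewrite lee_fin expR_ge0.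
have r0 : 0 <= l ^- n by rewrite invr_ge0 exprn_ge0// ltW.
rewrite /gauss_mass (eq_set_function_integral _ _ lebE).
rewrite (eq_set_function_integral _ _ lebE) -/F.
have -> : (\int[L]_x (expR (- (b * l ^+ 2) * dnorm dot x ^+ 2))%:E =
    (l ^- n)%:E * \int[L]_x F x)%E.
  transitivity (\int[L]_x F (l *: x))%E.
    apply: eq_integral => x _; rewrite /F dnormZ gtr0_norm//; congr (expR _)%:E.
    by ring.
  transitivity (\int[pushforward L (fun x : Z => l *: x)]_x F x)%E.
    by rewrite ge0_integral_pushforward//; exact: measurable_scaleV.
  transitivity (\int[mscale (NngNum r0) L]_x F x)%E.
    apply: eq_set_function_integral => A mA.
    exact: translation_invariant_scale.
  by rewrite ge0_integral_mscale.
(* [gauss_mass] is a [fine] value: an infinite integral would be read as 0 on both sides, so the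
   identity holds in that case as well. *)
have : (0 <= \int[L]_x F x)%E by exact: integral_ge0.
case: (\int[L]_x F x)%E => [s _|_|]//=.
by rewrite mulr0 mulry gtr0_sg ?mul1e// invr_gt0 exprn_gt0.
Qed.

End thermal_weight.

(** * S_lambda, its inverse and the conjugated maps *)

Section S_map_geometry.
Context (R : realType) (n : nat) (dot : {dot 'rV[R]_n for idfun}).
Local Notation Z := 'rV[R]_n.
Variables (a : Z) (E0 : {vspace Z}) (k : nat) (e : 'I_k -> Z).
Hypothesis eE : forall i, e i \in E0.
Hypothesis eO : orthonormal_family dot e.
Hypothesis ex : forall x, x \in E0 -> transport dot e e x = x.

Local Notation E := (affine_subspace a E0).
Local Notation P := (orthogonal_complement dot E0).

Lemma S_invK (l : R) q : l != 0 -> S_map l (S_inv dot a E0 l q) = q.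
Proof.
case: q => y z l0; rewrite /S_inv /S_map !scalerA mulVf// !scale1r.
by rewrite addrC subrK subKr.
Qed.

Lemma S_inv_triples (l : R) q : E q.2 -> triples dot a E0 (S_inv dot a E0 l q).
Proof.
case: q => y z /= /affineP zE; rewrite /S_inv (orth_projE a eE eO ex).
have pE := pr_in dot eE (y - a).
split; first split => /=.
- by apply/affineP; rewrite addrC addKr.
- apply/perpP; apply: memvZ; apply/perpP.
  by rewrite opprD addrA; exact: perp_sub_pr.
- apply: memvZ; rewrite (_ : _ - z = transport dot e e (y - a) - (z - a)).
    exact: rpredB.
  by rewrite opprB [RHS]addrCA addrA.
Qed.

Lemma S_map_snd (l : R) p : triples dot a E0 p -> E (S_map l p).2.
Proof.
case: p => -[xi eta] zeta [[/= /affineP xE _] zE]; apply/affineP.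
by rewrite addrAC rpredB// memvZ.
Qed.

(** [lift_fst T] keeps the second coordinate, which lies in E, and [S_inv] sends Z x E to triples.
    The formula for the weight is thus available at the conjugated point too. *)
Lemma S_conj_triples (l : R) (T : Z -> Z) p : triples dot a E0 p ->
  triples dot a E0 (S_conj dot a E0 l (lift_fst T) p).
Proof. by move=> /(S_map_snd l) pE; exact: S_inv_triples. Qed.

Lemma S_map_conj (l : R) (T : Z -> Z) p : l != 0 ->
  S_map l (S_conj dot a E0 l (lift_fst T) p) = lift_fst T (S_map l p).
Proof. by move=> l0; exact: S_invK. Qed.

(* On triples eta and zeta are orthogonal, hence
   ||(xi + eta/l) - (xi - zeta/l)||^2 = (||eta||^2 + ||zeta||^2) / l^2. *)
Lemma thermal_weight_S_map (b l : R) p : 0 < l -> triples dot a E0 p ->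
  thermal_weight dot (b * l ^+ 2) (S_map l p) =
  (gauss_mass dot (b * l ^+ 2))^-1 *
    expR (- b * dnorm dot p.1.2 ^+ 2 - b * dnorm dot p.2 ^+ 2).
Proof.
case: p => -[xi eta] zeta l0 [[/= _ etaP] zetaE]; rewrite /thermal_weight/=.
congr (_ * expR _).
rewrite opprB addrC addrA subrK -scalerDr dnormZ normfV gtr0_norm//.
rewrite exprMn !sqr_dnorm dotDl !dotDr.
rewrite (dotC dot zeta eta) (etaP zeta zetaE) addr0 add0r.
by field; rewrite gt_eqF.
Qed.

End S_map_geometry.

(** * The limit of the thermalized measures *)

Section thermalized_limit.
Context (R : realType) (n : nat) (dot : {dot 'rV[R]_n for idfun}).
Local Notation Z := 'rV[R]_n.
Variables (a : Z) (E0 : {vspace Z}) (k : nat) (e f : 'I_k -> Z).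
Hypothesis nk : n = (k + k)%N.
Hypothesis eE : forall i, e i \in E0.
Hypothesis eO : orthonormal_family dot e.
Hypothesis ex : forall x, x \in E0 -> transport dot e e x = x.
Hypothesis fP : forall i, f i \in orthov dot E0.
Hypothesis fO : orthonormal_family dot f.
Hypothesis fx : forall x, x \in orthov dot E0 -> transport dot f f x = x.

Local Notation E := (affine_subspace a E0).
Local Notation P := (orthogonal_complement dot E0).
Local Notation hE := (hausdorff_on dot k E).
Local Notation hP := (hausdorff_on dot k P).
Local Notation h0 := (hausdorff_on dot k [set` E0]).

Variables (L nuE nuP nu0 : {sigma_finite_measure set Z -> \bar R}).
Hypothesis lebE : forall A, measurable A -> lebesgue A = L A.
Hypothesis LD : translation_invariant L.
Hypothesis LC : forall r : R, 0 <= r -> L (@cube R n r) = ((r *+ 2) ^+ n)%:E.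
Hypothesis hEE : forall [A : set Z], measurable A -> hE A = nuE A.
Hypothesis hPE : forall [A : set Z], measurable A -> hP A = nuP A.
Hypothesis h0E : forall [A : set Z], measurable A -> h0 A = nu0 A.
Hypothesis finE : compact_finite nuE.
Hypothesis finP : compact_finite nuP.
Hypothesis nuE_neq0 : nuE setT != 0%E.

Local Notation nuEP := (nuE \x nuP)%E.
Local Notation H3 := (nuE \x nuP \x nu0)%E.

(** [rho] is the density L_D as given pointwise, [v] its Borel minorant: limits and bounds are
    assumed for [rho], integrals are taken with [v]. *)
Variables (rho v : Z -> R).
Hypothesis mv : measurable_fun setT v.
Hypothesis v0 : forall x, 0 <= v x.
Hypothesis v_rho : forall x, v x <= rho x.
Hypothesis rho_lim : {ae hE, forall xi, E xi ->
  {ae hP, forall eta, P eta ->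
    rho (xi + l^-1 *: eta) @[l --> +oo] --> rho xi}}.

Variables (b0 : R) (beta lambda : nat -> R).
Hypothesis b0_gt0 : 0 < b0.
Hypothesis lambda_gt0 : forall h, 0 < lambda h.
Hypothesis betaE : forall h, beta h = b0 * lambda h ^+ 2.
Hypothesis lambda_oo : lambda @ \oo --> +oo.

Variables (mu : {measure set (Z * Z) -> \bar R})
  (mu_ : nat -> {measure set (Z * Z) -> \bar R}) (T : nat -> Z -> Z).
Hypothesis mT : forall h, measurable_fun setT (T h).
Hypothesis muE : forall X, measurable X -> mu X = density (L \x nuE)%E (v \o fst) X.
Hypothesis mu_E : forall h X, measurable X -> mu_ h X = mu (lift_fst (T h) @^-1` X).
Hypothesis T_cvg : forall p, triples dot a E0 p ->
  S_conj dot a E0 (lambda h) (lift_fst (T h)) p @[h --> \oo] --> p.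

Variables (g g' : Z * Z * Z -> R) (h1 : nat).
Hypothesis ig' : H3.-integrable setT (EFin \o g').
Hypothesis gg' : {ae H3, forall p, g p = g' p}.
Hypothesis T_dom : forall h, (h1 <= h)%N -> forall p, triples dot a E0 p ->
  let: (xi, eta, zeta) := p in
  let: (xi', eta', zeta') := S_conj dot a E0 (lambda h) (lift_fst (T h)) p in
  (w_hat dot b0 eta zeta + w_hat dot b0 eta' zeta')
    * rho (xi + (lambda h)^-1 *: eta) <= g p.

Let mE : measurable E := measurable_affine a eE ex.
Let mP : measurable P := measurable_perp eE eO ex.
Let m0 : measurable [set` E0] := measurable_direction eE ex.

Lemma ae_triples : {ae H3, forall p, triples dot a E0 p}.
Proof.
have Eneg : H3.-negligible ((~` E `*` [set: Z]) `*` [set: Z]).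
  apply/negligibleP.
    by apply: measurableX => //; apply: measurableX => //; exact: measurableC.
  apply: product_null1.
    by apply: measurableX => //; exact: measurableC.
  exact: (product_null1 _ (measurableC mE) (affine_full eE ex hEE)).
have Pneg : H3.-negligible (([set: Z] `*` ~` P) `*` [set: Z]).
  apply/negligibleP.
    by apply: measurableX => //; apply: measurableX => //; exact: measurableC.
  apply: product_null1.
    by apply: measurableX => //; exact: measurableC.
  exact: (product_null2 _ (measurableC mP) (perp_full eE eO ex hPE)).
have Zneg : H3.-negligible ([set: Z * Z] `*` ~` [set` E0]).
  apply/negligibleP; first by apply: measurableX => //; exact: measurableC.
  exact: (product_null2 _ (measurableC m0) (direction_full eE ex h0E)).
apply: negligibleS (negligibleU (negligibleU Eneg Pneg) Zneg).
move=> [[xi eta] zeta] /= /not_andP[/not_andP[xE|yP]|zE].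
- by left; left.
- by left; right.
- by right.
Qed.

Let vS h (q : Z * Z) := v (q.1 + (lambda h)^-1 *: q.2).

Let mvS h : measurable_fun setT (vS h).
Proof.
apply: (measurableT_comp mv); apply: continuous_measurable_rV2.
apply: continuous_addf => [x|]; first exact: cvg_fst.
apply: continuous_scalef => [|x]; first exact: cst_continuous.
exact: cvg_snd.
Qed.

(* The exceptional set of (ii) need not be Borel, so Fubini is applied to the
   Borel set on which v is eventually bounded along lambda_h instead. *)
Lemma ae_bounded : {ae H3, forall p, exists C m : nat,
  forall h, (m <= h)%N -> vS h p.1 <= C%:R}.
Proof.
pose G : set (Z * Z) := \bigcup_(C : nat) \bigcup_(m : nat)
  \bigcap_(h in [set h | (m <= h)%N]) [set q | vS h q <= C%:R].
have mG : measurable G.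
  apply: bigcupT_measurable => C; apply: bigcupT_measurable => m.
  apply: bigcap_measurable; first by exists m => /=.
  move=> h _; rewrite -[X in measurable X]setTI.
  rewrite (_ : [set q | _] = vS h @^-1` `]-oo, C%:R]%classic).
    exact: mvS.
  by apply/seteqP; split => q /=; rewrite in_itv.
have G0 : nuEP (~` G) = 0%E.
  rewrite /product_measure1.
  have mCG : measurable (~` G) by exact: measurableC.
  rewrite (ge0_ae_eq_integral measurableT (g := cst 0%E)) ?integral0//.
    exact: measurable_fun_xsection.
  have [N [mN N0 subN]] := rho_lim.
  exists (N `|` ~` E); split.
  - by apply: measurableU => //; exact: measurableC.
  - apply/eqP; rewrite eq_le measure_ge0 andbT.
    apply: (le_trans (measureU2 _ mN (measurableC mE))).
    rewrite [X in (_ + X <= _)%E](affine_full eE ex hEE) adde0.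
    by rewrite -[X in (X <= _)%E](hEE mN) N0.
  move=> xi /= hxi; apply: contrapT => /not_orP[Nxi /contrapT xE]; apply: hxi => _.
  have /(_ xE) : E xi -> {ae hP, forall eta, P eta ->
    rho (xi + l^-1 *: eta) @[l --> +oo] --> rho xi}.
    by apply: contrapT => h; apply: Nxi; exact: subN.
  move=> [M [mM M0 subM]].
  apply: (@subset_measure0 _ _ _ nuP _ (M `|` ~` P)).
  - exact: measurable_xsection.
  - by apply: measurableU => //; exact: measurableC.
  - move=> eta; rewrite /xsection/= inE => nG.
    apply: contrapT => /not_orP[Meta /contrapT etaP]; apply: nG.
    have /(_ etaP) rlim : P eta -> rho (xi + l^-1 *: eta) @[l --> +oo] --> rho xi.
      by apply: contrapT => h; apply: Meta; exact: subM.
    have rlim' : rho (xi + (lambda h)^-1 *: eta) @[h --> \oo] --> rho xi.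
      exact: (cvg_comp _ _ lambda_oo rlim).
    have [m _ mP'] : \forall h \near \oo,
        rho (xi + (lambda h)^-1 *: eta) <= rho xi + 1.
      by apply: (cvgr_le _ rlim'); rewrite ltrDl.
    exists (Num.truncn (rho xi + 1)).+1 => //; exists m => // h /= mh.
    apply: (le_trans (v_rho _)); apply: (le_trans (mP' h mh)).
    exact/ltW/truncnS_gt.
  - apply/eqP; rewrite eq_le measure_ge0 andbT.
    apply: (le_trans (measureU2 _ mM (measurableC mP))).
    rewrite [X in (_ + X <= _)%E](perp_full eE eO ex hPE) adde0.
    by rewrite -[X in (X <= _)%E](hPE mM) M0.
exists (~` G `*` setT); split.
- by apply: measurableX => //; exact: measurableC.
- exact: (product_null1 _ (measurableC mG) G0).
- move=> [q z] /= h; split => // -[C _ [m _ Gq]]; apply: h.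
  by exists C, m => h mh; exact: Gq.
Qed.

(** The factor lambda^(-2k) from the change of variables cancels against B_(beta_h) = lambda^(-n)
    B_b0, since n = 2k. *)
Lemma weight_S_map h p : triples dot a E0 p ->
  lambda h ^- (k + k) * thermal_weight dot (beta h) (S_map (lambda h) p) =
  w_hat dot b0 p.1.2 p.2.
Proof.
move=> pt; rewrite betaE (thermal_weight_S_map _ (lambda_gt0 h) pt).
have lkn : lambda h ^- n = lambda h ^- (k + k) by congr (_ ^- _).
rewrite (gauss_mass_scale dot b0 lebE LD LC (lambda_gt0 h)) lkn /w_hat mulrA.
by rewrite invfM invrK mulrA mulVf ?mul1r// expf_neq0// gt_eqF.
Qed.

Let whF (F : Z * Z -> R) (q : Z * Z * Z) (l : R) :=
  F (S_map l q) * w_hat dot b0 q.1.2 q.2.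

(** To be applied to the constant sequence p and to the conjugated points, which tend to p by (v):
    both have the same limit, so their difference tends to 0. *)
Lemma cvg_whF (F : Z * Z -> R) (q_ : nat -> Z * Z * Z) (p : Z * Z * Z) :
  continuous F -> q_ h @[h --> \oo] --> p ->
  whF F (q_ h) (lambda h) @[h --> \oo] --> F (p.1.1, p.1.1) * w_hat dot b0 p.1.2 p.2.
Proof.
move=> cF qp.
have q1 : (q_ h).1 @[h --> \oo] --> p.1 by apply: (cvg_comp _ _ qp); exact: cvg_fst.
have q2 : (q_ h).2 @[h --> \oo] --> p.2 by apply: (cvg_comp _ _ qp); exact: cvg_snd.
have q11 : (q_ h).1.1 @[h --> \oo] --> p.1.1 by apply: (cvg_comp _ _ q1); exact: cvg_fst.
have q12 : (q_ h).1.2 @[h --> \oo] --> p.1.2 by apply: (cvg_comp _ _ q1); exact: cvg_snd.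
have l0 : (lambda h)^-1 @[h --> \oo] --> 0.
  by apply/gtr0_cvgV0; [exact: nearW|].
apply: cvgM.
  apply: (cvg_comp (fun h => S_map (lambda h) (q_ h)) F); last exact: cF.
  rewrite (_ : (fun _ => _) = fun h =>
    ((q_ h).1.1 + (lambda h)^-1 *: (q_ h).1.2, (q_ h).1.1 - (lambda h)^-1 *: (q_ h).2)).
    apply: (@cvg_pair _ _ _ _ (nbhs p.1.1) (nbhs p.1.1)) => /=.
      by have := cvgD q11 (cvgZ l0 q12); rewrite scale0r addr0; exact.
    by have := cvgB q11 (cvgZ l0 q2); rewrite scale0r subr0; exact.
  by apply/funext => h; case: (q_ h) => -[].
apply: cvgM; first exact: cvg_cst.
have d1 : dnorm dot (q_ h).1.2 @[h --> \oo] --> dnorm dot p.1.2.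
  by apply: (cvg_comp _ _ q12); exact: continuous_dnorm.
have d2 : dnorm dot (q_ h).2 @[h --> \oo] --> dnorm dot p.2.
  by apply: (cvg_comp _ _ q2); exact: continuous_dnorm.
apply: (cvg_comp (fun h => - b0 * dnorm dot (q_ h).1.2 ^+ 2 -
  b0 * dnorm dot (q_ h).2 ^+ 2) expR); last exact: continuous_expR.
apply: cvgB; apply: cvgM; try exact: cvg_cst; exact: cvgM.
Qed.

Lemma ae_integrand_cvg (F : Z * Z -> R) : continuous F ->
  {ae H3, forall p, triples dot a E0 p ->
    vS h p.1 * (whF F (S_conj dot a E0 (lambda h) (lift_fst (T h)) p) (lambda h) -
                whF F p (lambda h)) @[h --> \oo] --> 0}.
Proof.
move=> cF; apply: filterS ae_bounded => p [C [m pC]] pt.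
have d0 : whF F (S_conj dot a E0 (lambda h) (lift_fst (T h)) p) (lambda h) -
    whF F p (lambda h) @[h --> \oo] --> 0.
  rewrite -(subrr (F (p.1.1, p.1.1) * w_hat dot b0 p.1.2 p.2)); apply: cvgB.
    exact: cvg_whF (T_cvg pt).
  by apply: cvg_whF => //; exact: cvg_cst.
set d := (fun h => _ - _) in d0.
have d0' : C%:R * `|d h| @[h --> \oo] --> 0.
  by rewrite -(mulr0 C%:R); apply: cvgM; [exact: cvg_cst|exact/norm_cvg0P].
apply/norm_cvg0P; apply: squeeze_cvgr (cvg_cst 0) d0'.
exists m => // h /= mh; rewrite normr_ge0 normrM ger0_norm ?v0//.
by rewrite ler_wpM2r// pC.
Qed.

Let mlift h : measurable_fun setT (lift_fst (T h)).
Proof.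
apply/measurable_fun_pairP; split; last exact: measurable_snd.
exact: (measurableT_comp (mT h) measurable_fst).
Qed.

(** [u_] and [w_] are written with T_h S p and the original weight, in which form measurability on
    the whole space is immediate; only on triples are they rewritten through [S_conj] and
    [w_hat]. *)
Let u_ (F : Z * Z -> R) h p := F (lift_fst (T h) (S_map (lambda h) p)) *
  (lambda h ^- (k + k) * thermal_weight dot (beta h)
     (lift_fst (T h) (S_map (lambda h) p))) * vS h p.1.

Let w_ (F : Z * Z -> R) h p := F (S_map (lambda h) p) *
  (lambda h ^- (k + k) * thermal_weight dot (beta h) (S_map (lambda h) p)) *
  vS h p.1.

Lemma dominated_thermal (F : Z * Z -> R) (M : R) : continuous F ->
  (forall q, 0 <= F q) -> (forall q, F q <= M) ->
  [/\ forall h, (h1 <= h)%N -> (\int[H3]_p (u_ F h p)%:E < +oo)%E,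
      forall h, (h1 <= h)%N -> (\int[H3]_p (w_ F h p)%:E < +oo)%E &
      (\int[H3]_p (u_ F h p)%:E - \int[H3]_p (w_ F h p)%:E)%E @[h --> \oo]
        --> 0%E].
Proof.
move=> cF F0 FM.
have mF : measurable_fun setT F.
  have [B bB] := measurable_base_prod (rational_ball_base R n) (rational_ball_base R n).
  exact: continuous_measurable_base bB cF.
have mS h := measurable_S_map (n := n) (lambda h).
have mTS h : measurable_fun setT (fun p => lift_fst (T h) (S_map (lambda h) p)).
  exact: (measurableT_comp (mlift h) (mS h)).
have mvS1 h : measurable_fun setT (fun p : Z * Z * Z => vS h p.1).
  exact: (measurableT_comp (mvS h) measurable_fst).
have l0 h : 0 <= lambda h ^- (k + k) by rewrite invr_ge0 exprn_ge0// ltW.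
have uwE h p : triples dot a E0 p ->
    u_ F h p = vS h p.1 * whF F (S_conj dot a E0 (lambda h) (lift_fst (T h)) p) (lambda h)
    /\ w_ F h p = vS h p.1 * whF F p (lambda h).
  move=> pt; have pt' := S_conj_triples eE eO ex (lambda h) (T h) pt.
  rewrite /u_ /w_ /whF weight_S_map// -(weight_S_map h pt').
  rewrite (S_map_conj dot a E0 (T h) p) ?gt_eqF//.
  by split; rewrite mulrC.
(* The majorant M g' combines F <= M, [v <= rho] and the bound on the sum of the two Gaussians in
   (vi), with [g'] the Borel representative of [g]. *)
apply: (@dominated_difference _ _ _ H3 (u_ F) (w_ F) (fun p => M%:E * (g' p)%:E)%E h1).
- move=> h; apply: measurable_funM; last exact: mvS1.
  apply: measurable_funM; first exact: (measurableT_comp mF (mTS h)).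
  apply: measurable_funM => //.
  exact: (measurableT_comp (measurable_thermal_weight dot (beta h)) (mTS h)).
- move=> h; apply: measurable_funM; last exact: mvS1.
  apply: measurable_funM; first exact: (measurableT_comp mF (mS h)).
  apply: measurable_funM => //.
  exact: (measurableT_comp (measurable_thermal_weight dot (beta h)) (mS h)).
- move=> h p; apply: mulr_ge0; last exact: v0.
  by apply: mulr_ge0 => //; apply: mulr_ge0 => //; exact: thermal_weight_ge0.
- move=> h p; apply: mulr_ge0; last exact: v0.
  by apply: mulr_ge0 => //; apply: mulr_ge0 => //; exact: thermal_weight_ge0.
- exact: integrableZl ig'.
- move=> h hh; apply: filterS2 ae_triples gg' => p pt gp.
  have [-> ->] := uwE h p pt; rewrite -EFinM lee_fin -mulrDr.
  have := T_dom hh pt; case: p pt gp => -[xi eta] zeta pt gp.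
  have pt' := S_conj_triples eE eO ex (lambda h) (T h) pt.
  case: (S_conj _ _ _ _ _ _) pt' => -[xi' eta'] zeta' pt'; rewrite gp /whF/=.
  move=> dom; have M0 : 0 <= M := le_trans (F0 (0, 0)) (FM _).
  apply: le_trans (ler_wpM2l M0 dom).
  have wh0 y z : 0 <= w_hat dot b0 y z.
    by rewrite mulr_ge0 ?invr_ge0 ?gauss_mass_ge0 ?expR_ge0.
  rewrite mulrC [leRHS]mulrA; apply: ler_pM => //.
  - by apply: addr_ge0; apply: mulr_ge0.
  - exact: v0.
  - by rewrite mulrDr addrC; apply: lerD; apply: ler_wpM2r.
  - exact: v_rho.
- apply: filterS2 ae_triples (ae_integrand_cvg cF) => p pt /(_ pt) H.
  rewrite (_ : (fun h => _) = (fun h => vS h p.1 *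
    (whF F (S_conj dot a E0 (lambda h) (lift_fst (T h)) p) (lambda h) -
     whF F p (lambda h)))); first exact: H.
  by apply/funext => h; have [-> ->] := uwE h p pt; rewrite mulrBr.
Qed.

(** As mu_h is the image of mu under T_h, both integrals become integrals against [mu], and a single
    change of variables serves both with the same [c]. *)
Lemma integral_thermalized : exists2 c : R, 0 < c &
  forall h (F : Z * Z -> R), measurable_fun setT F -> (forall q, 0 <= F q) ->
  (\int[thermalized dot (beta h) (mu_ h)]_q (F q)%:E =
     c%:E * \int[H3]_p (u_ F h p)%:E)%E /\
  (\int[thermalized dot (beta h) mu]_q (F q)%:E =
     c%:E * \int[H3]_p (w_ F h p)%:E)%E.
Proof.
have [c c0 cE] :=
  lebesgue_S_map eE eO ex fP fO fx LD LC hEE hPE h0E finE finP nuE_neq0.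
exists c => // h F mF F0.
have mtw := measurable_thermal_weight dot (beta h).
have tw0 q : 0 <= thermal_weight dot (beta h) q by exact: thermal_weight_ge0.
have lk0 : 0 <= lambda h ^- (k + k) by rewrite invr_ge0 exprn_ge0// ltW.
have mv1 : measurable_fun setT (v \o (@fst Z Z)) by exact: measurableT_comp.
have mS := measurable_S_map (n := n) (lambda h).
have muG (G : Z * Z -> R) : measurable_fun setT G -> (forall q, 0 <= G q) ->
    (\int[mu]_q (G q)%:E =
    c%:E * \int[H3]_p (G (S_map (lambda h) p) * lambda h ^- (k + k) * vS h p.1)%:E)%E.
  move=> mG G0.
  transitivity (\int[mdensity (L \x nuE)%E mv1 (fun q => v0 q.1)]_q (G q)%:E)%E.
    exact: eq_set_function_integral.
  rewrite integral_mdensity//; last exact/measurable_EFinP.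
  rewrite (cE _ (lambda_gt0 h) (fun q => (G q)%:E * (v q.1)%:E)%E); last 2 first.
  - by apply: emeasurable_funM; exact/measurable_EFinP.
  - by move=> q; rewrite mule_ge0 ?lee_fin.
  rewrite EFinM -muleA; congr (_ * _)%E; rewrite -ge0_integralZl//.
  - by apply: eq_integral => -[[xi eta] zeta] _; rewrite -!EFinM /vS/=;
      congr EFin; ring.
  - apply/measurable_EFinP; apply: measurable_funM.
      exact: (measurableT_comp mG mS).
    exact: (measurableT_comp mv1 mS).
  - by move=> p _; rewrite lee_fin mulr_ge0.
split.
  transitivity (\int[mdensity (mu_ h) mtw tw0]_q (F q)%:E)%E => //.
  rewrite integral_mdensity//; last exact/measurable_EFinP.
  transitivity (\int[pushforward mu (lift_fst (T h))]_q
      (F q * thermal_weight dot (beta h) q)%:E)%E.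
    by apply: eq_set_function_integral => X mX; exact: mu_E.
  rewrite ge0_integral_pushforward//; last 2 first.
  - by apply/measurable_EFinP; exact: measurable_funM.
  - by move=> q _; rewrite lee_fin mulr_ge0.
  rewrite (muG (fun q => F (lift_fst (T h) q) *
    thermal_weight dot (beta h) (lift_fst (T h) q))).
  - by congr (_ * _)%E; apply: eq_integral => p _; rewrite /u_; congr EFin; ring.
  - apply: measurable_funM; first exact: (measurableT_comp mF (mlift h)).
    exact: (measurableT_comp mtw (mlift h)).
  - by move=> q; rewrite mulr_ge0.
transitivity (\int[mdensity mu mtw tw0]_q (F q)%:E)%E => //.
rewrite integral_mdensity//; last exact/measurable_EFinP.
rewrite (muG (fun q => F q * thermal_weight dot (beta h) q)).
- by congr (_ * _)%E; apply: eq_integral => p _; rewrite /w_; congr EFin; ring.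
- exact: measurable_funM.
- by move=> q; rewrite mulr_ge0.
Qed.

Let B_ h F := (\int[thermalized dot (beta h) (mu_ h)]_q (F q)%:E)%E.
Let A_ h F := (\int[thermalized dot (beta h) mu]_q (F q)%:E)%E.

Lemma thermalized_difference_ge0 (F : Z * Z -> R) (M : R) : continuous F ->
  (forall q, 0 <= F q) -> (forall q, F q <= M) ->
  (forall h, (h1 <= h)%N -> (B_ h F < +oo)%E /\ (A_ h F < +oo)%E) /\
  (B_ h F - A_ h F)%E @[h --> \oo] --> 0%E.
Proof.
move=> cF F0 FM; have [uoo woo uw] := dominated_thermal cF F0 FM.
have mF : measurable_fun setT F.
  have [B bB] := measurable_base_prod (rational_ball_base R n) (rational_ball_base R n).
  exact: continuous_measurable_base bB cF.
have [c c0 cE] := integral_thermalized.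
split=> [h hh|].
  have [BE AE] := cE h F mF F0; rewrite /B_ /A_ BE AE.
  by split; apply: lte_mul_pinfty; rewrite ?lee_fin ?ltW ?uoo ?woo.
have u0 h : (0 <= \int[H3]_p (u_ F h p)%:E)%E.
  apply: integral_ge0 => p _; rewrite lee_fin; apply: mulr_ge0; last exact: v0.
  by apply: mulr_ge0 => //; rewrite mulr_ge0 ?thermal_weight_ge0// invr_ge0
    exprn_ge0// ltW.
have w0 h : (0 <= \int[H3]_p (w_ F h p)%:E)%E.
  apply: integral_ge0 => p _; rewrite lee_fin; apply: mulr_ge0; last exact: v0.
  by apply: mulr_ge0 => //; rewrite mulr_ge0 ?thermal_weight_ge0// invr_ge0
    exprn_ge0// ltW.
have H : (c%:E * (\int[H3]_p (u_ F h p)%:E - \int[H3]_p (w_ F h p)%:E))%E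
    @[h --> \oo] --> 0%E.
  by rewrite -(mule0 c%:E); apply: cvgeZl.
apply: cvg_trans H; apply: near_eq_cvg; exists h1 => // h /= hh.
have [BE AE] := cE h F mF F0; rewrite /B_ /A_ BE AE muleBr//.
by rewrite fin_num_adde_defr// ge0_fin_numE ?uoo.
Qed.

Lemma thermalized_difference_cvg : radon mu -> (forall h, radon (mu_ h)) ->
  (forall h, (h1 <= h)%N -> bounded_radon (thermalized dot (beta h) (mu_ h)) /\
     bounded_radon (thermalized dot (beta h) mu)) /\
  (forall F : Z * Z -> R, continuous F -> (exists M, forall x, `|F x| <= M) ->
    (B_ h F - A_ h F)%E @[h --> \oo] --> 0%E).
Proof.
move=> rmu rmu_.
have beta0 h : 0 <= beta h by rewrite betaE mulr_ge0 ?sqr_ge0// ltW.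
have mtw h := measurable_thermal_weight dot (beta h).
have tw0 h q : 0 <= thermal_weight dot (beta h) q by exact: thermal_weight_ge0.
split=> [h hh|F cF [M FM]].
  (* The constant function 1 tests the total masses. *)
  have c1 : continuous (cst 1 : Z * Z -> R) by exact: cst_continuous.
  have [/(_ h hh)[Boo Aoo] _] := thermalized_difference_ge0 c1
    (fun=> ler01) (fun=> lexx 1).
  have twM q : thermal_weight dot (beta h) q <= (gauss_mass dot (beta h))^-1.
    exact: thermal_weight_le.
  split.
    apply: (radon_density (rmu_ h) (mtw h) (tw0 h) twM).
    move: Boo; rewrite /B_ -[X in (X < _)%E]/(\int[mdensity (mu_ h) (mtw h) (tw0 h)]_q
      (cst 1%:E q))%E.
    by rewrite integral_cst// mul1e.
  apply: (radon_density rmu (mtw h) (tw0 h) twM).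
  move: Aoo; rewrite /A_ -[X in (X < _)%E]/(\int[mdensity mu (mtw h) (tw0 h)]_q
    (cst 1%:E q))%E.
  by rewrite integral_cst// mul1e.
(* Positive and negative parts: continuous, non-negative, bounded by M, with finite integrals for h
   >= h1, so that the differences recombine. *)
pose Fp q := (`|F q| + F q) / 2; pose Fm q := (`|F q| - F q) / 2.
have cnF : continuous (fun q => `|F q|).
  by apply: (continuous_compf cF); exact: norm_continuous.
have cFp : continuous Fp.
  move=> q; apply: cvgM; last exact: cvg_cst.
  by apply: cvgD; [exact: cnF|exact: cF].
have cFm : continuous Fm.
  move=> q; apply: cvgM; last exact: cvg_cst.
  by apply: cvgB; [exact: cnF|exact: cF].
have FN q : - `|F q| <= F q <= `|F q| by rewrite -ler_norml.
have Fp0 q : 0 <= Fp q by rewrite divr_ge0//; have /andP[? ?] := FN q; lra.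
have Fm0 q : 0 <= Fm q by rewrite divr_ge0//; have /andP[? ?] := FN q; lra.
have FpM q : Fp q <= M.
  by have /andP[? ?] := FN q; have := FM q; rewrite /Fp ler_pdivrMr//; lra.
have FmM q : Fm q <= M.
  by have /andP[? ?] := FN q; have := FM q; rewrite /Fm ler_pdivrMr//; lra.
have FE q : F q = Fp q - Fm q by rewrite /Fp /Fm; field.
have [pfin pcvg] := thermalized_difference_ge0 cFp Fp0 FpM.
have [mfin mcvg] := thermalized_difference_ge0 cFm Fm0 FmM.
have [B bB] := measurable_base_prod (rational_ball_base R n) (rational_ball_base R n).
have split_integral (m : {measure set (Z * Z) -> \bar R}) h :
    let I G := (\int[thermalized dot (beta h) m]_q (G q)%:E)%E in
    (I Fp < +oo)%E -> (I Fm < +oo)%E ->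
    [/\ I F = (I Fp - I Fm)%E, I Fp \is a fin_num & I Fm \is a fin_num].
  pose nu := mdensity m (mtw h) (tw0 h).
  have int (G : Z * Z -> R) : continuous G -> (forall q, 0 <= G q) ->
      (\int[nu]_q (G q)%:E < +oo)%E -> nu.-integrable setT (EFin \o G).
    move=> cG G0 Goo; apply/integrableP; split.
      by apply/measurable_EFinP; exact: continuous_measurable_base bB cG.
    by under eq_integral => q _ do rewrite /= ger0_norm//.
  move=> I Ip Im; split.
  - transitivity (\int[nu]_q (F q)%:E)%E => //.
    transitivity (\int[nu]_q ((Fp q)%:E - (Fm q)%:E))%E.
      by apply: eq_integral => q _; rewrite FE.
    by apply: integralB_EFin => //; exact: int.
  - rewrite ge0_fin_numE//; apply: (@integral_ge0 _ _ _ nu) => q _.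
    by rewrite lee_fin.
  - rewrite ge0_fin_numE//; apply: (@integral_ge0 _ _ _ nu) => q _.
    by rewrite lee_fin.
have H : ((B_ h Fp - A_ h Fp) - (B_ h Fm - A_ h Fm))%E @[h --> \oo] --> 0%E.
  by rewrite -[X in _ --> X](sube0 0%E); apply: cvgeB.
apply: cvg_trans H; apply: near_eq_cvg; exists h1 => // h /= hh.
have [Bp Ap] := pfin h hh; have [Bm Am] := mfin h hh.
have [BE Bpf Bmf] := split_integral (mu_ h) h Bp Bm.
have [AE Apf Amf] := split_integral mu h Ap Am.
rewrite /B_ /A_ BE AE -(fineK Bpf) -(fineK Bmf) -(fineK Apf) -(fineK Amf).
by rewrite -!EFinB; congr EFin; ring.
Qed.

End thermalized_limit.

(** * Degenerate measures and assembly of the theorem *)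

Lemma null_thermalized (R : realType) n (dot : {dot 'rV[R]_n for idfun})
    (b : R) (mu : {measure set ('rV[R]_n * 'rV[R]_n) -> \bar R}) : 0 < b ->
  radon mu -> (forall X, measurable X -> mu X = 0%E) ->
  bounded_radon (thermalized dot b mu) /\
  (forall f, \int[thermalized dot b mu]_q f q = 0)%E.
Proof.
move=> b0 rmu mu0.
have density0 D f : (\int[mu]_(q in D) f q = 0)%E.
  transitivity (\int[mzero]_(q in D) f q)%E; last exact: integral_measure_zero.
  exact: eq_set_function_integral.
split => [|f].
  have twM q : thermal_weight dot b q <= (gauss_mass dot b)^-1.
    by apply: thermal_weight_le; exact: ltW.
  apply: (radon_density rmu (measurable_thermal_weight dot b)
    (thermal_weight_ge0 dot b) twM).
  by rewrite /density density0.
transitivity (\int[mzero]_q f q)%E; last exact: integral_measure_zero.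
by apply: eq_set_function_integral => A _; exact: density0.
Qed.

Lemma integrable_eq_set_function d (T : measurableType d) (R : realType)
    (m1 : set T -> \bar R) (m2 : {measure set T -> \bar R}) (D : set T) f :
  (forall A, measurable A -> m1 A = m2 A) ->
  m1.-integrable D f -> m2.-integrable D f.
Proof.
move=> e /integrableP[mf foo]; apply/integrableP; split => //.
by rewrite -(eq_set_function_integral _ _ e).
Qed.

Lemma cvgry_sqrt (R : realType) (u : nat -> R) (b : R) : 0 < b ->
  u @ \oo --> +oo -> (fun h => Num.sqrt (u h / b)) @ \oo --> +oo.
Proof.
move=> b0 uoo; apply/cvgryPge => A.
have /cvgryPge/(_ (A ^+ 2 * b)) := uoo; apply: filterS => h uA.
rewrite (le_trans (ler_norm A))// -sqrtr_sqr ler_wsqrtr//.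
by rewrite ler_pdivlMr.
Qed.

Theorem theorem5p5 (R : realType) (N : nat) (N_gt0 : (0 < N)%N)
  (dot : {dot 'rV[R]_(2 * N) for idfun})
  (* E is the affine subspace a + E0 *)
  (a : 'rV[R]_(2 * N)) (E0 : {vspace 'rV[R]_(2 * N)}) (dimE : \dim E0 = N)
  (mu : {measure set ('rV[R]_(2 * N) * 'rV[R]_(2 * N)) -> \bar R})
  (mu_radon : radon mu)
  (* (i) *)
  (LD : 'rV[R]_(2 * N) -> R) (LD_ge0 : forall xi, 0 <= LD xi)
  (LD_loc : L1_loc (@lebesgue R (2 * N)) LD)
  (muE : forall A, measurable A ->
    mu A = (density (@lebesgue R (2 * N)) LD
              \x hausdorff_on dot N (affine_subspace a E0))%E A)
  (* (ii) *)
  (LD_lim :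
    {ae hausdorff_on dot N (affine_subspace a E0), forall xi,
      affine_subspace a E0 xi ->
      {ae hausdorff_on dot N (orthogonal_complement dot E0), forall eta,
        orthogonal_complement dot E0 eta ->
        LD (xi + lambda^-1 *: eta) @[lambda --> +oo] --> LD xi}})
  (* (iii) *)
  (g0 : 'rV[R]_(2 * N) * 'rV[R]_(2 * N) * 'rV[R]_(2 * N) -> R)
  (g0_L1 : L1 (hausdorff3 dot a E0 N) g0)
  (lambda0 beta0 : R) (lambda0_gt0 : 0 < lambda0) (beta0_gt0 : 0 < beta0)
  (LD_dom :
    {ae hausdorff3 dot a E0 N, forall p, triples dot a E0 p ->
      forall lambda, lambda0 <= lambda ->
        let: (xi, eta, zeta) := p in
        expR (- beta0 * (dnorm dot eta ^+ 2 + dnorm dot zeta ^+ 2))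
          * LD (xi + lambda^-1 *: eta) <= g0 p})
  (* the approximating measures *)
  (muD_ : nat -> {measure set 'rV[R]_(2 * N) -> \bar R})
  (muD_radon : forall h, radon (muD_ h))
  (mu_ : nat -> {measure set ('rV[R]_(2 * N) * 'rV[R]_(2 * N)) -> \bar R})
  (mu_h_radon : forall h, radon (mu_ h))
  (mu_hE : forall h A, measurable A ->
    mu_ h A = (muD_ h \x hausdorff_on dot N (affine_subspace a E0))%E A)
  (beta lambda : nat -> R) (beta_gt0 : forall h, 0 < beta h)
  (beta_oo : beta @ \oo --> +oo)
  (lambdaE : forall h, lambda h = Num.sqrt (beta h / beta0))
  (* (iv) *)
  (TD : nat -> 'rV[R]_(2 * N) -> 'rV[R]_(2 * N))
  (TD_borel : forall h, measurable_fun setT (TD h))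
  (muD_hE : forall h A, measurable A ->
    muD_ h A = pushforward (density (@lebesgue R (2 * N)) LD) (TD h) A)
  (* (v) *)
  (T_cvg : forall p, triples dot a E0 p ->
    S_conj dot a E0 (lambda h) (lift_fst (TD h)) p @[h --> \oo] --> p)
  (* (vi) *)
  (g : 'rV[R]_(2 * N) * 'rV[R]_(2 * N) * 'rV[R]_(2 * N) -> R)
  (g_L1 : L1 (hausdorff3 dot a E0 N) g) (h0 : nat)
  (T_dom : forall h, (h0 <= h)%N -> forall p, triples dot a E0 p ->
    let: (xi, eta, zeta) := p in
    let: (xi', eta', zeta') :=
      S_conj dot a E0 (lambda h) (lift_fst (TD h)) p in
    (w_hat dot beta0 eta zeta + w_hat dot beta0 eta' zeta')
      * LD (xi + (lambda h)^-1 *: eta) <= g p) :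
  (\forall h \near \oo,
     bounded_radon (thermalized dot (beta h) (mu_ h)) /\
     bounded_radon (thermalized dot (beta h) mu)) /\
  (forall f : 'rV[R]_(2 * N) * 'rV[R]_(2 * N) -> R,
     continuous f -> (exists M, forall x, `|f x| <= M) ->
     (\int[thermalized dot (beta h) (mu_ h)]_x (f x)%:E
        - \int[thermalized dot (beta h) mu]_x (f x)%:E)%E @[h --> \oo]
       --> 0%:E).
Proof.
have hE_ge0 B : (0 <= hausdorff_on dot N (affine_subspace a E0) B)%E.
  exact: hausdorff_ge0.
have [L [LE Linv Lcube]] := lebesgue_row R (2 * N).
have [w' [mw' intw'] LDw'] := LD_loc.
have aeL : {ae L, forall x, LD x = w' x} := negligible_eq LE LDw'.
have [v [mv v0 vLD vae vdens]] := ae_measurable_minorant LD_ge0 mw' aeL.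
pose dens := mdensity L mv v0.
have densE A : measurable A -> density (@lebesgue R (2 * N)) LD A = dens A.
  by move=> mA; rewrite /density (eq_set_function_integral _ _ LE); exact: vdens.
have dens_fin K : compact K -> (dens K < +oo)%E.
  move=> cK; have mK := compact_measurable_rV cK.
  have /integrableP[_ ] := integrable_eq_set_function LE (intw' K cK).
  apply: le_lt_trans; apply: ae_ge0_le_integral => //.
  - by move=> x _; rewrite lee_fin.
  - by apply/measurable_EFinP; exact: measurable_funTS.
  - apply: measurableT_comp => //; apply/measurable_EFinP.
    exact: measurable_funTS.
  - apply: filterS2 vae aeL => x vx LDx _ /=; rewrite lee_fin vx LDx.
    exact: ler_norm.
have muX X : measurable X ->
    mu X = (dens \x hausdorff_on dot N (affine_subspace a E0))%E X.
  by move=> mX; rewrite muE//; exact: eq_set_function_integral.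
have muDE h A : measurable A -> muD_ h A = dens (TD h @^-1` A).
  move=> mA; rewrite muD_hE// /pushforward densE//.
  by rewrite -[X in measurable X]setTI; exact: TD_borel.
have trivial_case : (forall X, measurable X -> mu X = 0%E) ->
    (forall h X, measurable X -> mu_ h X = 0%E) ->
    (\forall h \near \oo, bounded_radon (thermalized dot (beta h) (mu_ h)) /\
       bounded_radon (thermalized dot (beta h) mu)) /\
    (forall f : 'rV[R]_(2 * N) * 'rV[R]_(2 * N) -> R,
       continuous f -> (exists M, forall x, `|f x| <= M) ->
       (\int[thermalized dot (beta h) (mu_ h)]_x (f x)%:E
          - \int[thermalized dot (beta h) mu]_x (f x)%:E)%E @[h --> \oo]
         --> 0%:E).
  move=> mu0 mu_0; split=> [|f _ _].
    apply: nearW => h.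
    have [? _] := null_thermalized dot (beta_gt0 h) (mu_h_radon h) (mu_0 h).
    by have [? _] := null_thermalized dot (beta_gt0 h) mu_radon mu0.
  rewrite (_ : (fun h => _) = cst 0%E); first exact: cvg_cst.
  apply/funext => h.
  have [_ ->] := null_thermalized dot (beta_gt0 h) (mu_h_radon h) (mu_0 h).
  by have [_ ->] := null_thermalized dot (beta_gt0 h) mu_radon mu0; rewrite sube0.
have [dens0|dens_neq0] := eqVneq (dens setT) 0%E.
  have dens0A A : measurable A -> dens A = 0%E.
    move=> mA; apply/eqP; rewrite eq_le measure_ge0 andbT -dens0.
    by apply: le_measure; rewrite ?inE.
  apply: trivial_case => [X mX|h X mX].
    rewrite muX// /product_measure1.
    transitivity (\int[mzero]_x (hausdorff_on dot N (affine_subspace a E0)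
      \o xsection X) x)%E; last exact: integral_measure_zero.
    exact: eq_set_function_integral.
  rewrite mu_hE// /product_measure1.
  transitivity (\int[mzero]_x (hausdorff_on dot N (affine_subspace a E0)
    \o xsection X) x)%E; last exact: integral_measure_zero.
  apply: eq_set_function_integral => A mA; rewrite muDE// dens0A//.
  by rewrite -[X in measurable X]setTI; exact: TD_borel.
(* Cubes exhaust Z, so one of them has positive mu_D-mass, and local integrability makes that mass
   finite. This cube is the set by which mu is divided to recover H^N|E. *)
have [j densj] : exists j : nat, dens (@cube R (2 * N) j%:R) != 0%E.
  apply: contrapT => /forallNP dens0; move/eqP: dens_neq0; apply.
  apply/negligibleP => //; rewrite -bigcup_cube; apply: negligible_bigcup => j.
  apply/negligibleP; first exact: measurable_cube.
  by apply/eqP/negPn/negP; exact: dens0.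
have cj : compact (@cube R (2 * N) j%:R) by exact: compact_cube.
have densj_gt0 : (0 < dens (@cube R (2 * N) j%:R))%E by rewrite lt0e densj measure_ge0.
have [nuE0 nuE0E] := right_factor_measure hE_ge0 muX (@measurable_cube R _ j%:R)
  densj_gt0 (dens_fin _ cj).
(* mu(cube x K) is finite since mu is Radon and cube x K is compact; as the cube has positive mass,
   the factor at K cannot be infinite. *)
have finE0 : compact_finite nuE0.
  move=> K cK; have mK := compact_measurable_rV cK.
  have [_ muK] := nuE0E K mK.
  have : (mu (cube j%:R `*` K) < +oo)%E.
    by have [_ + _] := mu_radon; apply; exact: compact_setX.
  rewrite muK !ltey; apply: contra => /eqP ->.
  by rewrite gt0_muley.
have [nuE nuEE] := compact_finite_pack finE0.
have hEE A : measurable A ->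
    hausdorff_on dot N (affine_subspace a E0) A = nuE A.
  by move=> mA; rewrite nuEE; have [] := nuE0E A mA.
have finE : compact_finite nuE by move=> K cK; rewrite nuEE; exact: finE0.
have [nuE_0|nuE_neq0] := eqVneq (nuE setT) 0%E.
  have hE0 (X : set ('rV[R]_(2 * N) * 'rV[R]_(2 * N))) x : measurable X ->
      hausdorff_on dot N (affine_subspace a E0) (xsection X x) = 0%E.
    move=> mX; have mXx : measurable (xsection X x) by exact: measurable_xsection.
    rewrite hEE//; apply/eqP; rewrite eq_le measure_ge0 andbT -nuE_0.
    by apply: le_measure; rewrite ?inE.
  apply: trivial_case => [X mX|h X mX].
    by rewrite muX//; apply: integral0_eq => x _; apply: hE0.
  by rewrite mu_hE//; apply: integral0_eq => x _; apply: hE0.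
have [e [eE eO ex]] := orthonormal_basis dot E0; rewrite dimE in e eE eO ex.
have dimP : \dim (orthov dot E0) = N.
  have := dimv_orthov dot E0; rewrite dimE; set d := \dim _ => dN.
  by apply/eqP; rewrite -(eqn_add2l N) dN mul2n addnn.
have [f [fP fO fx]] := orthonormal_basis dot (orthov dot E0).
rewrite dimP in f fP fO fx.
have [nu0 h0E fin0] := hausdorff_direction_measure hEE finE.
have [nuP hPE finP] := hausdorff_perp_measure eE eO ex fP fO fx h0E fin0.
have H3E A : measurable A -> hausdorff3 dot a E0 N A = (nuE \x nuP \x nu0)%E A.
  move=> mA; apply: product_measure1_eq => // B mB.
  exact: product_measure1_eq.
have [g' ig gg'] := g_L1.
have ig' : (nuE \x nuP \x nu0)%E.-integrable setT (EFin \o g').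
  exact: integrable_eq_set_function ig.
have gg'' : {ae (nuE \x nuP \x nu0)%E, forall p, g p = g' p}.
  exact: negligible_eq gg'.
have lambda_gt0 h : 0 < lambda h by rewrite lambdaE sqrtr_gt0 divr_gt0.
have betaE h : beta h = beta0 * lambda h ^+ 2.
  rewrite lambdaE sqr_sqrtr; last by rewrite divr_ge0// ltW.
  by rewrite mulrC divfK// gt_eqF.
have lambda_oo : lambda @ \oo --> +oo.
  by rewrite (_ : lambda = fun h => Num.sqrt (beta h / beta0));
    [exact: cvgry_sqrt|exact/funext].
have muv X : measurable X -> mu X = density (L \x nuE)%E (v \o fst) X.
  move=> mX; rewrite -(density_product L nuE mv v0 mX) muX//.
  exact: product_measure1_eq.
(* Push-forward acts on the first factor only: the section at x of the preimage of X is the section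
   of X at [TD h x]. *)
have mu_T h X : measurable X -> mu_ h X = mu (lift_fst (TD h) @^-1` X).
  move=> mX; have mTX : measurable (lift_fst (TD h) @^-1` X).
    rewrite -[X in measurable X]setTI; apply: (_ : measurable_fun setT _) => //.
    apply/measurable_fun_pairP; split; last exact: measurable_snd.
    exact: (measurableT_comp (TD_borel h) measurable_fst).
  rewrite mu_hE// muX// /product_measure1.
  transitivity (\int[pushforward dens (TD h)]_x (nuE \o xsection X) x)%E.
    transitivity (\int[muD_ h]_x (nuE \o xsection X) x)%E.
      by apply: eq_integral => x _ /=; rewrite hEE//; exact: measurable_xsection.
    by apply: eq_set_function_integral => A mA; rewrite muDE.
  rewrite ge0_integral_pushforward//; last exact: measurable_fun_xsection.
  apply: eq_integral => x _ /=; rewrite hEE; last exact: measurable_xsection.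
  congr (nuE _); apply/seteqP; split => y; rewrite /xsection/= !inE//.
have nN : (2 * N = N + N)%N by rewrite mul2n addnn.
have [rad lim] := thermalized_difference_cvg nN eE eO ex fP fO fx
  LE Linv Lcube hEE hPE h0E finE finP nuE_neq0 mv v0 vLD LD_lim beta0_gt0
  lambda_gt0 betaE lambda_oo TD_borel muv mu_T T_cvg ig' gg'' T_dom mu_radon
  mu_h_radon.
by split; [exists h0|exact: lim].
Qed.
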